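(* Let $\boldsymbol{k}$ be a field and let $A$ be a standard-graded, Artinian, Gorenstein $\boldsymbol{k}$-algebra (with $A_0=\boldsymbol{k}$) of embedding codimension three, i.e. $\dim_{\boldsymbol{k}}A_1=3$. Let $S=\operatorname{Sym}_\bullet^{\boldsymbol{k}}(A_1)$ and write $A=S/J$. Assume that the minimal homogeneous resolution of $A$ by free $S$-modules is Gorenstein-linear, i.e. has the form $$0\to S(-2n-1)^{s_3}\to S(-n-1)^{s_2}\to S(-n)^{s_1}\to S$$ for some integers $n$ and $s_1,s_2,s_3$ (so $n\ge 2$ and the socle degree of $A$ is $2n-2$). Fix a $\boldsymbol{k}$-basis $x,y,z$ of $A_1$ and let $$\Phi_A=\sum_{m}\alpha_m m^*\in D_{2n-2}^{\boldsymbol{k}}(A_1^* ),\qquad \alpha_m\in\boldsymbol{k},$$ ($m$ ranging over the monomials of degree $2n-2$ in $x,y,z$) be a Macaulay inverse system for $A$, i.e. $J=\operatorname{ann}_S(\Phi_A)$. Let $(\mathbb B,b)$ be the complex of free $\mathfrak R$-modules, $\mathfrak R=\mathbb Z[x,y,z,\{t_m\}]$, described in the context for this integer $n$, and regard $S$ as an $\mathfrak R$-algebra via the ring homomorphism $x\mapsto x$, $y\mapsto y$, $z\mapsto z$, $t_m\mapsto \alpha_m$. Then $S\otimes_{\mathfrak R}\mathbb B$ is a minimal homogeneous resolution of $A$ by free $S$-modules. Furthermore, $S\otimes_{\mathfrak R}\mathbb B$ is explicitly constructed in a polynomial manner from the coefficients of the Macaulay inverse system of $A$: the entries of its matrices are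 obtained from the entries of the matrices of $\mathbb B$, which are elements of $\mathbb Z[x,y,z,\{t_m\}]$ depending only on $n$, by substituting $t_m=\alpha_m$.
   Context: For a set of variables and $N\ge0$, $\binom{x,y,z}{N}$ (resp. $\binom{y,z}{N}$) denotes the set of monomials of degree $N$ in $x,y,z$ (resp. in $y,z$). Divided powers. If $V$ is a free module of finite rank over a commutative ring $K$ with basis $x,y,z$, then $D_N^K(V^* )=\operatorname{Hom}_K(\operatorname{Sym}_N^K V,K)$, and $D_\bullet^K(V^* )=\bigoplus_N D^K_N(V^* )$ is a $\operatorname{Sym}_\bullet^K V$-module by $[\mu(\nu)](\mu')=\nu(\mu\mu')$. For $m\in\binom{x,y,z}{N}$, $m^*\in D_N^K(V^* )$ is the dual basis element; thus $x_i(m^* )=(m/x_i)^*$ if $x_i$ divides $m$ and $0$ otherwise. If $\mu,\nu$ have the same degree, then $\mu(\nu)=\nu(\mu)\in K$. $\operatorname{ann}_S(\Phi_A)=\{f\in S: f(\Phi_A)=0\}$. The complex $(\mathbb B,b)$. Fix an integer $n\ge2$. Let $U$ be a free $\mathbb Z$-module with basis $x,y,z$, and $U_0=\mathbb Zy\oplus\mathbb Zz$. $D_N^{\mathbb Z}(U_0^* )$ is viewed inside $D_N^{\mathbb Z}(U^* )$ as the span of the $m^*$ with $m\in\binom{y,z}{N}$. Let $\mathfrak R=\operatorname{Sym}_\bullet^{\mathbb Z}(U\oplus\operatorname{Sym}_{2n-2}^{\mathbb Z}U)$, bigraded with $U=\mathfrak R_{(1,0)}$ and $\operatorname{Sym}_{2n-2}^{\mathbb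 Z}U=\mathfrak R_{(0,1)}$; that is, $\mathfrak R=\mathbb Z[x,y,z,\{t_m\mid m\in\binom{x,y,z}{2n-2}\}]$. Let $\Psi:\operatorname{Sym}_\bullet^{\mathbb Z}U\to\mathfrak R$ be the $\mathbb Z$-algebra map induced by $U=\mathfrak R_{(1,0)}$ (extended $\mathfrak R$-linearly to $\mathfrak R\otimes_{\mathbb Z}\operatorname{Sym}_\bullet^{\mathbb Z} U$), and let $\Phi:\operatorname{Sym}_{2n-2}^{\mathbb Z}U\to\mathfrak R$ be the inclusion $\operatorname{Sym}_{2n-2}^{\mathbb Z}U=\mathfrak R_{(0,1)}$, so $\Phi(m)=t_m$; also view $\Phi=\sum_m t_m\otimes m^*\in\mathfrak R\otimes D_{2n-2}^{\mathbb Z}(U^* )$. All maps below are extended $\mathfrak R$-linearly as needed. Let $p:\operatorname{Sym}_{n-1}^{\mathbb Z}U\to\mathfrak R\otimes D_{n-1}^{\mathbb Z}(U^* )$ be $p(\mu)=\mu(\Phi)$, i.e. $[p(\mu)](\mu')=\Phi(\mu\mu')$. Its matrix in the monomial basis and the dual basis is $T=(t_{m_1m_2})$, $m_1,m_2\in\binom{x,y,z}{n-1}$. Let $\boldsymbol\delta=\det T$, let $Q=(Q_{m_1,m_2})$ be the classical adjoint (adjugate) of $T$, let $q:D_{n-1}^{\mathbb Z}(U^* )\to\mathfrak R\otimes\operatorname{Sym}_{n-1}^{\mathbb Z}U$ be the classical adjoint of $p$, $q(m_2^* )=\sum_{m_1}Q_{m_1,m_2}\otimes m_1$, and let $\mathfrak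 Q(\nu\otimes\nu')=[q(\nu)](\nu')\in\mathfrak R$. Let $\widetilde\Phi=\sum_{m\in\binom{x,y,z}{2n-2}}t_m\otimes(xm)^*\in\mathfrak R\otimes D_{2n-1}^{\mathbb Z}(U^* )$; it is the element with $x(\widetilde\Phi)=\Phi$ and $\mu(\widetilde\Phi)=0$ for all $\mu\in\operatorname{Sym}_{2n-1}^{\mathbb Z}U_0$. For $\mu,\mu'\in\operatorname{Sym}_{n-1}^{\mathbb Z}U_0$ and $\nu,\nu'\in D_n^{\mathbb Z}(U_0^* )$ set $$\beta_1(\nu\wedge\nu')=\Psi(x)[\mathfrak Q(z(\nu)\otimes y(\nu'))-\mathfrak Q(y(\nu)\otimes z(\nu'))],$$ $$\beta_2(\mu\otimes\nu)=\Psi(x)[\mathfrak Q((z\mu)(\widetilde\Phi)\otimes y(\nu))-\mathfrak Q((y\mu)(\widetilde\Phi)\otimes z(\nu))],$$ $$\beta_3(\mu\wedge\mu')=\Psi(x)[\mathfrak Q((z\mu)(\widetilde\Phi)\otimes(y\mu')(\widetilde\Phi))-\mathfrak Q((y\mu)(\widetilde\Phi)\otimes(z\mu')(\widetilde\Phi))].$$ Let $B_3=B_0=\mathfrak R$, $B_2=\mathfrak R\otimes_{\mathbb Z}(\operatorname{Sym}_{n-1}^{\mathbb Z}U_0\oplus D_n^{\mathbb Z}(U_0^* ))$, $B_1=B_2^*=\mathfrak R\otimes_{\mathbb Z}(D_{n-1}^{\mathbb Z}(U_0^* )\oplus\operatorname{Sym}_n^{\mathbb Z}U_0)$, and define $\mathfrak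 b:\bigwedge^2_{\mathfrak R}B_2\to\mathfrak R$ by $$\mathfrak b((\mu+\nu)\wedge(\mu'+\nu'))=\beta_3(\mu\wedge\mu')+\beta_2(\mu\otimes\nu')-\beta_2(\mu'\otimes\nu)+\beta_1(\nu\wedge\nu')+\Psi(y)\boldsymbol\delta([z\mu](\nu')-[z\mu'](\nu))-\Psi(z)\boldsymbol\delta([y\mu](\nu')-[y\mu'](\nu)).$$ The complex $(\mathbb B,b)$ is $0\to B_3\xrightarrow{b_3}B_2\xrightarrow{b_2}B_1\xrightarrow{b_1}B_0$, where $[b_2(\theta)](\theta')=\mathfrak b(\theta\wedge\theta')$ for $\theta,\theta'\in B_2$; $b_1(\nu)=\Psi(x)\Psi(q(\nu))$ for $\nu\in D_{n-1}^{\mathbb Z}(U_0^* )$; $b_1(\mu)=\boldsymbol\delta\,\Psi(\mu)-\Psi(x)\Psi(q(\mu(\widetilde\Phi)))$ for $\mu\in\operatorname{Sym}_n^{\mathbb Z}U_0$; and $b_3(1)=b_1$, viewed as an element of $B_1^*=B_2$. *)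

(* Defs.v *)
From mathcomp Require Import all_boot all_order all_algebra.
From mathcomp Require Import mpoly.

Set Implicit Arguments.
Unset Strict Implicit.
Unset Printing Implicit Defensive.

Import GRing.Theory.
Local Open Scope ring_scope.

Section Algebra.
Variables (k : fieldType) (A : comAlgType k).
Implicit Types (gr I : nat -> A -> Prop) (X : 'I_3 -> A).

Definition subspace (P : A -> Prop) : Prop :=
  P 0 /\ forall (c : k) a b, P a -> P b -> P (c *: a + b).

Definition subalgebra (P : A -> Prop) : Prop :=
  [/\ subspace P, P 1 & forall a b, P a -> P b -> P (a * b)].

Definition ideal (P : A -> Prop) : Prop :=
  [/\ P 0, forall a b, P a -> P b -> P (a + b)
    & forall a b, P b -> P (a * b)].

(* [gr i] is the homogeneous component A_i. *)
Record standard_graded gr : Prop := StandardGraded {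
  gr_subspace : forall i, subspace (gr i);
  gr_mul : forall i j a b, gr i a -> gr j b -> gr (i + j)%N (a * b);
  gr_sum : forall a, exists N (c : nat -> A),
    (forall i, gr i (c i)) /\ a = \sum_(i < N) c i;
  gr_direct : forall N (c : nat -> A), (forall i, gr i (c i)) ->
    \sum_(i < N) c i = 0 -> forall i, (i < N)%N -> c i = 0;
  gr_0 : forall a, gr 0 a <-> exists c : k, a = c *: 1;
  gr_generated : forall P : A -> Prop, subalgebra P ->
    (forall a, gr 1 a -> P a) -> forall a, P a
}.

Definition artinian : Prop :=
  forall I, (forall i, ideal (I i)) ->
    (forall i a, I i.+1 a -> I i a) ->
    exists N, forall i, (N <= i)%N -> forall a, I N a -> I i a.

(* The annihilator of the maximal homogeneous ideal. *)
Definition socle gr (a : A) : Prop :=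
  forall i b, (0 < i)%N -> gr i b -> b * a = 0.

(* For Artinian algebras with A_0 = k: the socle is one-dimensional. *)
Definition gorenstein gr : Prop :=
  exists s, [/\ socle gr s, s <> 0
              & forall a, socle gr a -> exists c : k, a = c *: s].

Definition socle_degree gr (d : nat) : Prop :=
  (exists2 a, gr d a & a <> 0) /\
  forall i a, (d < i)%N -> gr i a -> a = 0.

Definition is_basis1 gr X : Prop :=
  [/\ forall i, gr 1 (X i),
      forall c : 'I_3 -> k, \sum_i c i *: X i = 0 -> forall i, c i = 0
    & forall a, gr 1 a -> exists c : 'I_3 -> k, a = \sum_i c i *: X i].

(* The canonical surjection Sym(A_1) -> A, where Sym(A_1) is identified with
   the polynomial ring k[x,y,z] by means of the basis X of A_1. *)
Definition presentation X : {mpoly k[3]} -> A :=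
  mmap (GRing.in_alg A) X.

End Algebra.

(* 0 -> K^rk3 -> K^rk2 -> K^rk1 -> K.  Elements of K^r are row vectors and the
   differentials act by right multiplication: row i of a matrix is the image of
   the i-th basis vector. *)
Record complex3 (K : comNzRingType) := Complex3 {
  rk1 : nat; rk2 : nat; rk3 : nat;
  d1 : 'M[K]_(rk1, 1);
  d2 : 'M[K]_(rk2, rk1);
  d3 : 'M[K]_(rk3, rk2)
}.

Definition base_change (K L : comNzRingType) (phi : K -> L) (C : complex3 K) :
    complex3 L :=
  Complex3 (map_mx phi (d1 C)) (map_mx phi (d2 C)) (map_mx phi (d3 C)).

Section Resolution.
Variables (k : fieldType) (A : comAlgType k).
Local Notation S := {mpoly k[3]}.

(* The map (+)_i S(- e i) -> (+)_j S(- f j) given by M has degree zero. *)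
Definition homogeneous_mx r s (e : 'I_r -> nat) (f : 'I_s -> nat)
    (M : 'M[S]_(r, s)) : Prop :=
  forall i j m, m \in msupp (M i j) -> (mdeg m + f j)%N = e i.

(* The entries of M lie in the ideal (x,y,z). *)
Definition minimal_mx r s (M : 'M[S]_(r, s)) : Prop :=
  forall i j, (M i j)@_0%MM = 0.

(* C is a minimal homogeneous resolution, by free S-modules, of A regarded as
   an S-module through pi : S -> A, of the form
   0 -> (+)_i S(- e3 i) -> (+)_i S(- e2 i) -> (+)_i S(- e1 i) -> S. *)
Record min_hom_resolution (pi : S -> A) (C : complex3 S)
    (e1 : 'I_(rk1 C) -> nat) (e2 : 'I_(rk2 C) -> nat) (e3 : 'I_(rk3 C) -> nat)
    : Prop := MinHomResolution {
  res_hom1 : homogeneous_mx e1 (fun _ => 0%N) (d1 C);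
  res_hom2 : homogeneous_mx e2 e1 (d2 C);
  res_hom3 : homogeneous_mx e3 e2 (d3 C);
  res_min1 : minimal_mx (d1 C);
  res_min2 : minimal_mx (d2 C);
  res_min3 : minimal_mx (d3 C);
  res_onto : forall a, exists f, pi f = a;
  res_exact0 : forall f, pi f = 0 <-> exists v : 'rV_ _, (v *m d1 C) 0 0 = f;
  res_exact1 : forall v : 'rV_ _, v *m d1 C = 0 <-> exists w, v = w *m d2 C;
  res_exact2 : forall v : 'rV_ _, v *m d2 C = 0 <-> exists w, v = w *m d3 C;
  res_exact3 : forall v : 'rV_ _, v *m d3 C = 0 -> v = 0
}.

Definition pure_resolution (pi : S -> A) (C : complex3 S) (a1 a2 a3 : nat)
    : Prop :=
  @min_hom_resolution pi C (fun _ => a1) (fun _ => a2) (fun _ => a3).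

(* The minimal resolution of A has the form
   0 -> S(-2n-1)^s3 -> S(-n-1)^s2 -> S(-n)^s1 -> S. *)
Definition gorenstein_linear (pi : S -> A) (n s1 s2 s3 : nat) : Prop :=
  exists (M1 : 'M[S]_(s1, 1)) (M2 : 'M[S]_(s2, s1)) (M3 : 'M[S]_(s3, s2)),
    pure_resolution pi (Complex3 M1 M2 M3) n n.+1 (2 * n).+1.

End Resolution.

Definition ix : 'I_3 := @Ordinal 3 0 isT.
Definition iy : 'I_3 := @Ordinal 3 1 isT.
Definition iz : 'I_3 := @Ordinal 3 2 isT.

Definition mono (N : nat) := {u : 'X_{1..3 < N.+1} | mdeg u == N}.
Definition mval N (u : mono N) : 'X_{1..3} := bmnm (val u).

(* The monomial y^(N-i) z^i. *)
Definition yzmono (N i : nat) : 'X_{1..3} :=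
  (U_(iy) *+ (N - i) + U_(iz) *+ i)%MM.

Section DividedPowers.
Variable K : comNzRingType.

(* An element of D(V* ) is represented by its values on the monomials; those of
   D_N(V* ) = Hom(Sym_N V, K) vanish outside degree N. *)
Definition divpow := 'X_{1..3} -> K.

Definition dmono (m : 'X_{1..3}) : divpow := fun m' => (m' == m)%:R.

Definition dzero : divpow := fun _ => 0.

(* mu(nu) for mu in Sym(V): [mu(nu)](m') = nu(mu m'). *)
Definition contract (mu : {mpoly K[3]}) (nu : divpow) : divpow :=
  fun m' => \sum_(m <- msupp mu) mu@_m * nu (m + m')%MM.

(* nu(mu) = mu(nu) in K for mu and nu of the same degree. *)
Definition pairing (mu : {mpoly K[3]}) (nu : divpow) : K :=
  \sum_(m <- msupp mu) mu@_m * nu m.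

(* The element sum_m alpha_m m^* of D_N(V* ). *)
Definition divpow_of N (alpha : mono N -> K) : divpow :=
  fun m' => \sum_(u : mono N) alpha u * dmono (mval u) m'.

Definition annihilates (f : {mpoly K[3]}) (Phi : divpow) : Prop :=
  forall m, contract f Phi m = 0.

End DividedPowers.

(* Z[x, y, z, {t_m}], m ranging over the monomials of degree 2n-2: the first
   three variables are x, y, z. *)
Notation Rring n := {mpoly int[3 + #|{: mono (2 * n - 2)}|]}.

Section ComplexB.
Variable n : nat.

Local Notation RR := (Rring n).

Definition Xvar (i : 'I_3) : RR := 'X_(lshift _ i).
Definition tvar (u : mono (2 * n - 2)) : RR := 'X_(rshift 3 (enum_rank u)).

Local Notation Sym := {mpoly RR[3]}.
Local Notation D := (divpow RR).

Definition Psi (f : Sym) : RR := f.@[Xvar].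

Definition Phi : D := divpow_of tvar.

Definition Phit : D :=
  fun m' => \sum_(u : mono (2 * n - 2))
    tvar u * dmono RR (U_(ix) + mval u)%MM m'.

(* The rows and columns of T are indexed by an enumeration of the monomials of
   degree n-1. *)
Definition mon (i : 'I_#|{: mono (n - 1)}|) : 'X_{1..3} := mval (enum_val i).

Definition T : 'M[RR]_#|{: mono (n - 1)}| :=
  \matrix_(i, j) Phi (mon i + mon j)%MM.

Definition delta : RR := \det T.
Definition Q := \adj T.

Definition q (nu : D) : Sym :=
  \sum_j nu (mon j) *: \sum_i Q i j *: 'X_[mon i].

Definition QQ (nu nu' : D) : RR := pairing (q nu) nu'.

Local Notation x := ('X_ix : Sym).
Local Notation y := ('X_iy : Sym).
Local Notation z := ('X_iz : Sym).

Definition beta1 (nu nu' : D) : RR :=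
  Psi x * (QQ (contract z nu) (contract y nu')
           - QQ (contract y nu) (contract z nu')).

Definition beta2 (mu : Sym) (nu : D) : RR :=
  Psi x * (QQ (contract (z * mu) Phit) (contract y nu)
           - QQ (contract (y * mu) Phit) (contract z nu)).

Definition beta3 (mu mu' : Sym) : RR :=
  Psi x * (QQ (contract (z * mu) Phit) (contract (y * mu') Phit)
           - QQ (contract (y * mu) Phit) (contract (z * mu') Phit)).

(* bb theta theta' is the value of the alternating form on theta /\ theta',
   where the pair theta = (mu, nu) stands for mu + nu in B_2. *)
Definition bb (theta theta' : Sym * D) : RR :=
  let: (mu, nu) := theta in let: (mu', nu') := theta' in
  beta3 mu mu' + beta2 mu nu' - beta2 mu' nu + beta1 nu nu'
  + Psi y * delta * (pairing (z * mu) nu' - pairing (z * mu') nu)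
  - Psi z * delta * (pairing (y * mu) nu' - pairing (y * mu') nu).

(* b_1 on nu + mu in B_1, nu in D_{n-1}(U_0^* ) and mu in Sym_n(U_0). *)
Definition bb1 (theta : D * Sym) : RR :=
  let: (nu, mu) := theta in
  Psi x * Psi (q nu)
  + (delta * Psi mu - Psi x * Psi (q (contract mu Phit))).

(* B_2 has basis the monomials m of degree n-1 in y, z, followed by the m'^*
   for m' a monomial of degree n in y, z; B_1 = B_2^* has the dual basis. *)
Definition basis2 (i : 'I_(n + n.+1)) : Sym * D :=
  match split i with
  | inl j => ('X_[yzmono (n - 1) j], dzero RR)
  | inr j => (0, dmono RR (yzmono n j))
  end.

Definition basis1 (i : 'I_(n + n.+1)) : D * Sym :=
  match split i with
  | inl j => (dmono RR (yzmono (n - 1) j), 0)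
  | inr j => (dzero RR, 'X_[yzmono n j])
  end.

(* The coordinates of b_2(theta) in the basis of B_1 dual to [basis2] are the
   bb theta (basis2 j), and those of b_3(1) = b_1 in [basis2] are the values of
   b_1 on the dual basis. *)
Definition BB : complex3 RR :=
  @Complex3 RR (n + n.+1) (n + n.+1) 1
    (\matrix_(i, j) bb1 (basis1 i))
    (\matrix_(i, j) bb (basis2 i) (basis2 j))
    (\matrix_(i, j) bb1 (basis1 j)).

(* The substitution x |-> x, y |-> y, z |-> z, t_m |-> alpha_m. *)
Definition specialize (k : fieldType) (alpha : mono (2 * n - 2) -> k) :
    RR -> {mpoly k[3]} :=
  mmap intr
    (fun i => match split i with
              | inl j => 'X_j
              | inr j => (alpha (enum_val j))%:MP
              end).

End ComplexB.

(* Main.v *)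
From HB Require Import structures.
Require Import Defs.
From mathcomp Require Import all_boot all_order all_algebra.
From mathcomp Require Import mpoly ssrcomplements.
From mathcomp Require Import ring zify.

(** Write S = k[x,y,z], let phi be the inverse system, and let T be the matrix
    of f |-> f(phi) from S_(n-1) to its dual.  The assumed resolution has no
    generator of J in degree n-1, so T is invertible; its determinant delta is
    a nonzero scalar, and the adjoint q of T satisfies q(nu)(phi) = delta nu
    and is symmetric.  After substituting the coefficients of phi, the complex
    is determined by a column g of 2n+1 forms of degree n and a skew-symmetric
    matrix M of linear forms, the third differential being the transpose of g.

    Generators ([gens_expansion]).  Let phi' be the lift of phi with x phi' =
    phi that vanishes on k[y,z].  For f of degree n, f(phi) = 0 says exactly
    that f(phi') is supported on monomials in y, z; splitting f as f0(y,z) + x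
    f1 and applying q then expresses delta f as an explicit combination of the
    g_j.  So the g_j span J_n, which generates J by hypothesis, and they are
    visibly independent ([gens_free]).

    M g = 0 ([syz_gens]).  Put eta_s(theta) = (s mu)(phi') + s(nu) for theta =
    mu + nu and s = y, z.  The part of a row of M that is a multiple of x has
    as coefficients the coordinates, in the above expansion, of y q(eta_z) - z
    q(eta_y), which annihilates phi because z eta_y = y eta_z.  The remaining
    part telescopes to the opposite form.

    Exactness at the first step ([linear_syz], [syz_exact1]).  A linear syzygy
    of g is reduced by rows of M in two stages.  Modulo x it is a linear
    syzygy of the monomials of degree n in y, z, which the first n rows
    provide; the remaining y, z parts sit on the generators x q(nu), where
    contraction with phi turns the relation into one between divided powers
    in y, z, which the last n+1 rows provide.  What is left is x times a
    scalar relation, hence 0.  All syzygies are generated by linear ones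
    because this is so in the assumed resolution and both systems of
    generators span J_n.

    Exactness at the second step ([skew_exact]) is formal: the Koszul relations
    g_j e_i - g_i e_j are combinations of rows of M, so a vector v with v M = 0
    satisfies v_i g_j = v_j g_i, and J contains the regular sequence x^N, y^N,
    which forces v to be a multiple of g. *)

Set Implicit Arguments.
Unset Strict Implicit.
Unset Printing Implicit Defensive.

Import GRing.Theory.
Local Open Scope ring_scope.

(** * Monomials in three variables *)

Lemma mdeg3 (m : 'X_{1..3}) : mdeg m = (m ix + m iy + m iz)%N.
Proof.
rewrite mdegE !big_ord_recl big_ord0 addn0 addnA.
by congr (m _ + m _ + m _)%N; apply: val_inj.
Qed.

Lemma mnm3P (m m' : 'X_{1..3}) :
  m ix = m' ix -> m iy = m' iy -> m iz = m' iz -> m = m'.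
Proof.
move=> ex ey ez; apply/mnmP => -[[|[|[|//]]] lti].
- by rewrite (_ : Ordinal lti = ix) //; apply: val_inj.
- by rewrite (_ : Ordinal lti = iy) //; apply: val_inj.
- by rewrite (_ : Ordinal lti = iz) //; apply: val_inj.
Qed.

Lemma yzmonoE N i : ((yzmono N i ix = 0%N) * (yzmono N i iy = (N - i)%N)
  * (yzmono N i iz = i))%type.
Proof.
by do !split; rewrite /yzmono mnmDE !mulmnE !mnm1E /= ?mul0n ?mul1n ?addn0.
Qed.

Lemma mdeg_yzmono N i : (i <= N)%N -> mdeg (yzmono N i) = N.
Proof. by move=> leiN; rewrite mdeg3 !yzmonoE add0n subnK. Qed.

Lemma yzmono_inj N i j : yzmono N i = yzmono N j -> i = j.
Proof. by move=> /(congr1 (fun m : 'X_{1..3} => m iz)); rewrite !yzmonoE. Qed.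

Lemma eq_yzmono N i j : (yzmono N i == yzmono N j) = (i == j).
Proof. by apply/eqP/eqP => [/yzmono_inj|->]. Qed.

Lemma yzmonoP N (m : 'X_{1..3}) :
  mdeg m = N -> m ix = 0%N -> m = yzmono N (m iz) /\ (m iz < N.+1)%N.
Proof.
rewrite mdeg3 => + mx0; rewrite mx0 add0n => <-; split;
  last by rewrite ltnS leq_addl.
by apply: mnm3P; rewrite !yzmonoE ?addnK.
Qed.

Lemma addUy_yzmono N i : (i <= N)%N ->
  (U_(iy) + yzmono N i)%MM = yzmono N.+1 i.
Proof.
move=> leiN; apply: mnm3P; rewrite mnmDE mnm1E /= !yzmonoE //.
by rewrite subSn.
Qed.

Lemma addUz_yzmono N i : (U_(iz) + yzmono N i)%MM = yzmono N.+1 i.+1.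
Proof. by apply: mnm3P; rewrite mnmDE mnm1E /= !yzmonoE // subSS. Qed.

Lemma mono_of_mdeg N (m : 'X_{1..3}) : mdeg m = N ->
  exists u : mono N, mval u = m.
Proof.
move=> degm; have ltm : (mdeg m < N.+1)%N by rewrite degm.
have degb : mdeg (BMultinom ltm) == N by rewrite /= degm.
by exists (exist _ (BMultinom ltm) degb).
Qed.

Lemma mdeg_mval N (u : mono N) : mdeg (mval u) = N.
Proof. exact: (eqP (valP u)). Qed.

Lemma mval_inj N : injective (@mval N).
Proof. by move=> u v /val_inj/val_inj. Qed.

(** * Coefficients of homogeneous polynomials *)

Section Polynomials.
Variable K : comNzRingType.
Local Notation S := {mpoly K[3]}.
Implicit Types (f g : S) (m : 'X_{1..3}).

Lemma mcoeffXM f m m' : ('X_[m] * f)@_(m + m') = f@_m'.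
Proof. by rewrite mulrC mcoeffMX. Qed.

Lemma mcoeffXM_eq0 f m m' : ~~ (m <= m')%MM -> ('X_[m] * f)@_m' = 0.
Proof.
move=> nle; apply/eqP; rewrite mcoeff_eq0 mulrC (perm_mem (msuppMX _ _)).
apply: contra nle => /mapP[m'' _ ->]; exact: lem_addr.
Qed.

(** The quotient is produced together with its degree, so that dividing a form
    by a monomial keeps it homogeneous. *)
Lemma mpolyX_dvd f m : (forall m', ~~ (m <= m')%MM -> f@_m' = 0) ->
  exists2 g, f = 'X_[m] * g &
    forall d, f \is d.-homog -> g \is (d - mdeg m).-homog.
Proof.
move=> f0; have le_mm' m' : m' \in msupp f -> (m <= m')%MM.
  by apply: contraLR => /f0 fm'; rewrite mcoeff_msupp fm' eqxx.
exists (\sum_(m' <- msupp f) f@_m' *: 'X_[m' - m]) => [|d /dhomogP homf].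
  rewrite mulr_sumr {1}[f]mpolyE big_seq [RHS]big_seq.
  apply: eq_bigr => m' m'f; rewrite -scalerAr -mpolyXD.
  by congr (_ *: 'X_[_]); rewrite addmC submK // le_mm'.
rewrite big_seq; apply: rpred_sum => m' m'f; apply: rpredZ.
by rewrite dhomogX -(homf _ m'f) -{2}(submK (le_mm' _ m'f)) /= mdegD addnK.
Qed.

Lemma mcoeff_homog_eq0 d f m : f \is d.-homog -> mdeg m != d -> f@_m = 0.
Proof. exact: dhomog_nemf_coeff. Qed.

Lemma homogM d e f g :
  f \is d.-homog -> g \is e.-homog -> f * g \is (d + e).-homog.
Proof. exact: dhomogM. Qed.

Lemma homogX m : ('X_[m] : S) \is (mdeg m).-homog.
Proof. by rewrite dhomogX. Qed.

Lemma homogXM i d f : f \is d.-homog -> ('X_i * f) \is d.+1.-homog.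
Proof. by move=> homf; apply: (@homogM 1) => //; rewrite dhomogX /= mdeg1. Qed.

Lemma split_x N f : f \is N.-homog ->
  exists2 g, g \is (N - 1).-homog &
    f = \sum_(b < N.+1) f@_(yzmono N b) *: 'X_[yzmono N b] + 'X_ix * g.
Proof.
move=> homf.
have homs : \sum_(b < N.+1) f@_(yzmono N b) *: 'X_[yzmono N b] \is N.-homog.
  apply: rpred_sum => b _; apply: rpredZ; rewrite dhomogX /=.
  by rewrite mdeg_yzmono // -ltnS.
set s := (X in X \is _) in homs.
have [|g ef homg] := @mpolyX_dvd (f - s) U_(ix)%MM.
  move=> m'; rewrite lep1mP negbK => /eqP m'x.
  have [degm'|neqm'] := eqVneq (mdeg m') N; last first.
    by rewrite (mcoeff_homog_eq0 _ neqm') // rpredB.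
  have [em' ltm'] := yzmonoP degm' m'x.
  rewrite mcoeffB raddf_sum /= (bigD1 (Ordinal ltm')) //= big1 ?addr0.
    by rewrite -em' mcoeffZ mcoeffX eqxx mulr1 subrr.
  move=> b neqb; rewrite mcoeffZ mcoeffX em' eq_yzmono.
  by rewrite -val_eqE /= in neqb; rewrite (negPf neqb) mulr0.
exists g; last by rewrite -ef subrKC.
by have := homg N (rpredB homf homs); rewrite mdeg1.
Qed.

End Polynomials.

(** * The pairing of polynomials with divided powers *)

Section Pairing.
Variable K : comNzRingType.
Local Notation S := {mpoly K[3]}.
Implicit Types (f g : S) (nu : divpow K) (m : 'X_{1..3}).

Lemma pairingwE d f nu : (msize f <= d)%N ->
  pairing f nu = \sum_(m : 'X_{1..3 < d}) f@_m * nu m.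
Proof.
move=> lefd; set I : subFinType _ := 'X_{1..3 < d}.
rewrite /pairing (big_mksub I) ?msupp_uniq //=; last first.
  by move=> m /msize_mdeg_lt /leq_trans ->.
by rewrite big_rmcond //= => m /memN_msupp_eq0 ->; rewrite mul0r.
Qed.

Lemma pairing_is_linear nu : linear_for *%R (fun f => pairing f nu).
Proof.
move=> c f g /=; set d := maxn (msize (c *: f + g)) (maxn (msize f) (msize g)).
rewrite !(@pairingwE d) ?leq_max ?leqnn ?orbT // mulr_sumr -big_split /=.
by apply: eq_bigr => m _; rewrite mcoeffD mcoeffZ mulrDl mulrA.
Qed.

Lemma pairing0 nu : pairing 0 nu = 0.
Proof. by rewrite /pairing msupp0 big_nil. Qed.

Lemma pairingD f g nu : pairing (f + g) nu = pairing f nu + pairing g nu.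
Proof. by rewrite -[f]scale1r pairing_is_linear mul1r scale1r. Qed.

Lemma pairingZ c f nu : pairing (c *: f) nu = c * pairing f nu.
Proof. by rewrite -[c *: f]addr0 pairing_is_linear pairing0 addr0. Qed.

Lemma pairingB f g nu : pairing (f - g) nu = pairing f nu - pairing g nu.
Proof. by rewrite -scaleN1r pairingD pairingZ mulN1r. Qed.

Lemma pairing_sum I (r : seq I) P (F : I -> S) nu :
  pairing (\sum_(i <- r | P i) F i) nu = \sum_(i <- r | P i) pairing (F i) nu.
Proof.
by apply: (big_morph (fun f => pairing f nu)) => [f g|];
  rewrite ?pairing0 ?pairingD.
Qed.

Lemma pairingX m nu : pairing 'X_[m] nu = nu m.
Proof. by rewrite /pairing msuppX big_seq1 mcoeffX eqxx mul1r. Qed.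

Lemma pairing_mx_comb N (A : 'M[K]_N) (e : 'I_N -> 'X_{1..3}) nu nu' :
  pairing (\sum_j nu (e j) *: \sum_i A i j *: 'X_[e i]) nu' =
  \sum_j \sum_i nu (e j) * A i j * nu' (e i).
Proof.
rewrite pairing_sum; apply: eq_bigr => j _.
rewrite pairingZ pairing_sum mulr_sumr; apply: eq_bigr => i _.
by rewrite pairingZ pairingX mulrA.
Qed.

(** Everything about contraction is reduced to the pairing, which is linear in
    the polynomial. *)
Lemma contractE f nu m : contract f nu m = pairing (f * 'X_[m]) nu.
Proof.
rewrite [in RHS](mpolyE f) mulr_suml pairing_sum.
by apply: eq_bigr => m' _; rewrite -scalerAl -mpolyXD pairingZ pairingX.
Qed.

Lemma contractX m nu m' : contract 'X_[m] nu m' = nu (m + m')%MM.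
Proof. by rewrite contractE -mpolyXD pairingX. Qed.

Lemma pairing_dmono f m : pairing f (dmono K m) = f@_m.
Proof.
rewrite [in LHS](mpolyE f) pairing_sum [in RHS](mpolyE f) raddf_sum /=.
by apply: eq_bigr => m' _; rewrite pairingZ pairingX mcoeffZ mcoeffX.
Qed.

End Pairing.

(** * The adjoint of the catalecticant matrix *)

Section InverseSystem.
Variables (k : fieldType) (n : nat) (phi : divpow k).
Local Notation S := {mpoly k[3]}.
Local Notation x := ('X_ix : S).
Local Notation y := ('X_iy : S).
Local Notation z := ('X_iz : S).
Implicit Types (f g : S) (nu : divpow k) (m : 'X_{1..3}).

(** The lift phi' of phi described above. *)
Definition xlift : divpow k :=
  fun m => if m ix == 0%N then 0 else phi (m - U_(ix))%MM.

Lemma xliftE m : xlift (U_(ix) + m)%MM = phi m.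
Proof. by rewrite /xlift mnmDE mnm1E eqxx addmC addmK. Qed.

Lemma xlift_eq0 m : m ix = 0%N -> xlift m = 0.
Proof. by rewrite /xlift => ->. Qed.

Lemma pairing_shift f nu m :
  pairing f (fun m' => nu (m + m')%MM) = pairing (f * 'X_[m]) nu.
Proof.
rewrite -contractE; apply: eq_bigr => m' _; by rewrite addmC.
Qed.

Lemma pairing_xlift f : pairing (f * x) xlift = pairing f phi.
Proof.
by rewrite -pairing_shift; apply: eq_bigr => m _; rewrite xliftE.
Qed.

(** The catalecticant matrix, of f |-> f(phi) on forms of degree n-1. *)
Definition hankel : 'M[k]_#|{: mono (n - 1)}| :=
  \matrix_(i, j) phi (mon i + mon j)%MM.

Definition hdet : k := \det hankel.

Definition qmap nu : S :=
  \sum_j nu (mon j) *: \sum_i (\adj hankel) i j *: 'X_[mon i].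

Lemma mdeg_mon (i : 'I_#|{: mono (n - 1)}|) : mdeg (mon i) = (n - 1)%N.
Proof. exact: mdeg_mval. Qed.

Lemma monP m : mdeg m = (n - 1)%N -> exists i, m = @mon n i.
Proof.
by move=> /mono_of_mdeg[u <-]; exists (enum_rank u); rewrite /mon enum_rankK.
Qed.

Lemma mon_inj : injective (@mon n).
Proof. by move=> i j /mval_inj/enum_val_inj. Qed.

Lemma tr_hankel : hankel^T = hankel.
Proof. by apply/matrixP => i j; rewrite !mxE addmC. Qed.

Lemma tr_adj_hankel : (\adj hankel)^T = \adj hankel.
Proof.
apply/matrixP => i j; rewrite !mxE -cofactor_tr tr_hankel.
by [].
Qed.

Lemma qmap_homog nu : qmap nu \is (n - 1).-homog.
Proof.
apply: rpred_sum => j _; apply: rpredZ; apply: rpred_sum => i _.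
by apply: rpredZ; rewrite dhomogX /= mdeg_mon.
Qed.

Lemma pairing_qmap nu nu' : pairing (qmap nu) nu' =
  \sum_j \sum_i nu (mon j) * (\adj hankel) i j * nu' (mon i).
Proof. exact: pairing_mx_comb. Qed.

Lemma pairing_qmapC nu nu' : pairing (qmap nu) nu' = pairing (qmap nu') nu.
Proof.
rewrite !pairing_qmap exchange_big; apply: eq_bigr => j _;
  apply: eq_bigr => i _.
by rewrite -{1}tr_adj_hankel mxE mulrC mulrA mulrAC.
Qed.

(** This is T * adj T = det T, read through the contraction. *)
Lemma qmapP nu m : mdeg m = (n - 1)%N ->
  pairing (qmap nu * 'X_[m]) phi = hdet * nu m.
Proof.
move=> /monP[l ->]; rewrite -pairing_shift pairing_qmap.
transitivity (\sum_j nu (mon j) * (hankel *m \adj hankel) l j).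
  apply: eq_bigr => j _; rewrite mxE mulr_sumr; apply: eq_bigr => i _.
  rewrite [hankel l i]mxE -!mulrA; congr (_ * _); exact: mulrC.
rewrite mul_mx_adj (bigD1 l) //= mxE eqxx mulrC big1 ?addr0 // => j neqj.
by rewrite mxE eq_sym (negPf neqj) mulr0.
Qed.

Lemma eq_qmap nu nu' : (forall m, mdeg m = (n - 1)%N -> nu m = nu' m) ->
  qmap nu = qmap nu'.
Proof. by move=> eqnu; apply: eq_bigr => j _; rewrite eqnu // mdeg_mon. Qed.

Lemma qmap_sum (I : finType) (c : I -> k) (nu : I -> divpow k) :
  qmap (fun m => \sum_i c i * nu i m) = \sum_i c i *: qmap (nu i).
Proof.
under [RHS]eq_bigr do rewrite /qmap scaler_sumr.
rewrite exchange_big; apply: eq_bigr => j _; rewrite scaler_suml.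
by apply: eq_bigr => i _; rewrite scalerA.
Qed.

Lemma qmapD nu nu' : qmap (fun m => nu m + nu' m) = qmap nu + qmap nu'.
Proof. by rewrite -big_split; apply: eq_bigr => j _; rewrite scalerDl. Qed.

(** For the inverse system of an algebra with linear resolution this holds
    because the ideal starts in degree n. *)
Hypothesis nondeg : forall f, f \is (n - 1).-homog ->
  (forall m, mdeg m = (n - 1)%N -> pairing (f * 'X_[m]) phi = 0) -> f = 0.

Lemma hdet_neq0 : hdet != 0.
Proof.
apply/det0P => -[v /eqP v0 vT0]; apply: v0.
pose f := \sum_i v 0 i *: 'X_[mon i] : S.
have f0 : f = 0.
  apply: nondeg.
    by apply: rpred_sum => i _; apply: rpredZ; rewrite dhomogX /= mdeg_mon.
  move=> m /monP[l ->]; move/matrixP/(_ 0 l): vT0; rewrite !mxE => <-.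
  rewrite mulr_suml pairing_sum; apply: eq_bigr => i _.
  by rewrite -scalerAl -mpolyXD pairingZ pairingX mxE.
apply/rowP => l; rewrite mxE; move/(congr1 (mcoeff (mon l))): f0.
rewrite mcoeff0 raddf_sum (bigD1 l) //= mcoeffZ mcoeffX eqxx mulr1.
rewrite big1 ?addr0 // => i neqi; rewrite mcoeffZ mcoeffX.
by rewrite (inj_eq mon_inj) (negPf neqi) mulr0.
Qed.

Lemma qmapK f nu : f \is (n - 1).-homog ->
  (forall m, mdeg m = (n - 1)%N -> nu m = pairing (f * 'X_[m]) phi) ->
  qmap nu = hdet *: f.
Proof.
move=> homf nuE; apply/eqP; rewrite -subr_eq0; apply/eqP/nondeg.
  by apply: rpredB; [exact: qmap_homog | exact: rpredZ].
move=> m degm; rewrite mulrBl pairingB qmapP // -scalerAl pairingZ.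
by rewrite nuE // subrr.
Qed.

Hypothesis n_gt1 : (1 < n)%N.

Let n1K : (n - 1).+1 = n. Proof. by rewrite subn1 prednK // ltnW. Qed.
Let n2K : (n - 2).+1 = (n - 1)%N.
Proof. by rewrite -subSn. Qed.

Lemma ltn_le1 (a : 'I_n) : (a <= n - 1)%N.
Proof. by rewrite -ltnS n1K. Qed.

(** A divided power killed by x involves only y and z. *)
Lemma divpow_yz_expansion nu m :
  (forall m', mdeg m' = (n - 2)%N -> nu (U_(ix) + m')%MM = 0) ->
  mdeg m = (n - 1)%N ->
  nu m = \sum_(a < n) nu (yzmono (n - 1) a) * dmono k (yzmono (n - 1) a) m.
Proof.
move=> nux degm; have [mx0|mx] := eqVneq (m ix) 0%N.
  have [] := yzmonoP degm mx0; rewrite n1K; move: (m iz) => c -> ltc.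
  rewrite (bigD1 (Ordinal ltc)) //= /dmono eqxx mulr1 big1 ?addr0 // => a nea.
  by rewrite eq_yzmono eq_sym (val_eqE a (Ordinal ltc)) (negPf nea) mulr0.
rewrite -lep1mP in mx; rewrite -(submK mx) addmC.
rewrite nux; last first.
  by apply: succn_inj; rewrite n2K -degm -[in RHS](submK mx) mdegD mdeg1 addn1.
rewrite big1 // => a _; rewrite /dmono; case: eqP => [|_];
  last by rewrite mulr0.
move=> /(congr1 (fun m : 'X_{1..3} => m ix)).
by rewrite mnmDE mnm1E yzmonoE.
Qed.

(** * The generators of degree n *)

(** The entries of the first differential after substitution: the images of
    the duals of the monomials of degree n-1 in y, z, then those of the
    monomials of degree n in y, z. *)
Definition gens (i : 'I_(n + n.+1)) : S :=
  match split i with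
  | inl a => x * qmap (dmono k (yzmono (n - 1) a))
  | inr b => hdet *: 'X_[yzmono n b]
             - x * qmap (fun m => xlift (yzmono n b + m)%MM)
  end.

Lemma split_lshift p r (a : 'I_p) : split (lshift r a) = inl a.
Proof. exact: (unsplitK (inl a)). Qed.
Lemma split_rshift p r (b : 'I_r) : split (rshift p b) = inr b.
Proof. exact: (unsplitK (inr b)). Qed.

Lemma gensA a : gens (lshift _ a) = x * qmap (dmono k (yzmono (n - 1) a)).
Proof. by rewrite /gens split_lshift. Qed.

Lemma gensB b : gens (rshift _ b) =
  hdet *: 'X_[yzmono n b] - x * qmap (fun m => xlift (yzmono n b + m)%MM).
Proof. by rewrite /gens split_rshift. Qed.

Lemma xqmap_homog nu : x * qmap nu \is n.-homog.
Proof.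
by move: (homogXM ix (qmap_homog nu)); rewrite n1K.
Qed.

Lemma gens_homog i : gens i \is n.-homog.
Proof.
rewrite -(splitK i); case: (split i) => [a|b] /=.
  by rewrite gensA xqmap_homog.
rewrite gensB; apply: rpredB (xqmap_homog _); apply: rpredZ.
by rewrite dhomogX /= mdeg_yzmono // -ltnS.
Qed.

Lemma gens_annihilate i m : mdeg m = (n - 2)%N ->
  pairing (gens i * 'X_[m]) phi = 0.
Proof.
move=> degm; have degxm : mdeg (U_(ix) + m)%MM = (n - 1)%N.
  by rewrite mdegD mdeg1 degm add1n n2K.
have xq nu : pairing (x * qmap nu * 'X_[m]) phi = hdet * nu (U_(ix) + m)%MM.
  by rewrite -qmapP // mpolyXD mulrCA mulrA.
rewrite -(splitK i); case: (split i) => [a|b] /=.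
  rewrite gensA xq /dmono; case: eqP => [|_]; last by rewrite mulr0.
  move=> /(congr1 (fun m : 'X_{1..3} => m ix)).
  by rewrite mnmDE mnm1E yzmonoE.
rewrite gensB mulrBl pairingB xq -scalerAl pairingZ -mpolyXD pairingX.
by rewrite addmA [(_ + U_(ix))%MM]addmC -addmA xliftE subrr.
Qed.

(** Coordinates, up to the factor [hdet], of a form of the ideal in terms of
    [gens]: its monomials in y, z on the second block, and the divided power
    f(phi') in y, z on the first. *)
Definition gcoord f (j : 'I_(n + n.+1)) : k :=
  match split j with
  | inl a => pairing (f * 'X_[yzmono (n - 1) a]) xlift
  | inr b => f@_(yzmono n b)
  end.

(** Writing f = f0(y,z) + x f1, the second block of generators accounts for
    hdet f0 at the cost of - x q(f0(phi')).  What remains is x q of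
    f1(phi) + f0(phi') = f(phi'), and since x f(phi') = f(phi) = 0 this divided
    power lives in y, z, where the first block of generators produces it. *)
Lemma gens_expansion f : f \is n.-homog ->
  (forall m, mdeg m = (n - 2)%N -> pairing (f * 'X_[m]) phi = 0) ->
  hdet *: f = \sum_j gcoord f j *: gens j.
Proof.
move=> homf fphi; have [f1 homf1 ef] := split_x homf.
rewrite big_split_ord /=.
under eq_bigr do rewrite /gcoord split_lshift gensA scalerAr.
under [X in _ + X]eq_bigr do rewrite /gcoord split_rshift gensB scalerBr
  scalerA mulrC -scalerA scalerAr.
rewrite sumrB -!mulr_sumr -scaler_sumr -!qmap_sum.
rewrite (@eq_qmap (fun m => _) (fun m => pairing (f1 * 'X_[m]) phi +
   \sum_(b < n.+1) f@_(yzmono n b) * xlift (yzmono n b + m)%MM)); last first.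
  move=> m degm.
  rewrite -(@divpow_yz_expansion (fun m => pairing (f * 'X_[m]) xlift)) //.
    rewrite {1}ef mulrDl pairingD addrC; congr (_ + _).
      by rewrite -mulrA mulrC pairing_xlift.
    rewrite mulr_suml pairing_sum; apply: eq_bigr => b _.
    by rewrite -scalerAl pairingZ -mpolyXD pairingX.
  move=> m' degm'; rewrite addmC mpolyXD mulrA pairing_xlift; exact: fphi.
rewrite qmapD (qmapK homf1) // {1}ef scalerDr mulrDr scalerAr addrC.
by rewrite [X in _ = _ + X]addrC subrKA.
Qed.

(** * The skew-symmetric matrix of linear syzygies *)

(** For the basis element theta = mu + nu of B_2 indexed by j, this is
    (s mu)(phi') + s(nu), with s the variable y or z.  It merges the three forms
    beta_1, beta_2, beta_3 into the single expression [xcoef] below. *)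
Definition eta (s : 'I_3) (j : 'I_(n + n.+1)) : divpow k := fun m =>
  match split j with
  | inl a => xlift (U_(s) + yzmono (n - 1) a + m)%MM
  | inr b => dmono k (yzmono n b) (U_(s) + m)%MM
  end.

Definition xcoef i j : k :=
  pairing (qmap (eta iz i)) (eta iy j) - pairing (qmap (eta iy i)) (eta iz j).

Definition yzcoef (s : 'I_3) (i j : 'I_(n + n.+1)) : k :=
  match split i, split j with
  | inl a, inr b => dmono k (yzmono n b) (U_(s) + yzmono (n - 1) a)%MM
  | inr b, inl a => - dmono k (yzmono n b) (U_(s) + yzmono (n - 1) a)%MM
  | _, _ => 0
  end.

Definition syz : 'M[S]_(n + n.+1) :=
  \matrix_(i, j) (xcoef i j *: x
    + hdet *: (yzcoef iz i j *: y - yzcoef iy i j *: z)).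

Definition gens_col : 'cV[S]_(n + n.+1) := \col_i gens i.

Lemma pairing_eta f s j : pairing f (eta s j) = gcoord ('X_s * f) j.
Proof.
rewrite /gcoord /eta -(splitK j); case: (split j) => [a|b] /=.
  by rewrite split_lshift pairing_shift mpolyXD mulrA [f * 'X_s]mulrC.
by rewrite split_rshift pairing_shift pairing_dmono mulrC.
Qed.

Lemma gcoordB f g j : gcoord (f - g) j = gcoord f j - gcoord g j.
Proof.
by rewrite /gcoord; case: split => a; rewrite ?mcoeffB // mulrBl pairingB.
Qed.

(** The coefficients [xcoef] are the coordinates of the form
    y q(eta_z) - z q(eta_y).  That form annihilates phi: contracting it gives
    y eta_z - z eta_y up to the determinant, and both terms agree because
    multiplication by y and by z commute. *)
Lemma sum_xcoef i : \sum_j xcoef i j *: gens j =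
  hdet *: (y * qmap (eta iz i) - z * qmap (eta iy i)).
Proof.
have homq s s' : 'X_s * qmap (eta s' i) \is n.-homog.
  by move: (homogXM s (qmap_homog (eta s' i))); rewrite n1K.
have homF := rpredB (homq iy iz) (homq iz iy).
rewrite (gens_expansion homF).
  by apply: eq_bigr => j _; rewrite gcoordB -!pairing_eta.
move=> m degm; rewrite mulrBl pairingB.
have qE s s' : pairing ('X_s * qmap (eta s' i) * 'X_[m]) phi =
    hdet * eta s' i (U_(s) + m)%MM.
  rewrite -qmapP ?mdegD ?mdeg1 ?degm ?add1n ?n2K //.
  by rewrite mpolyXD mulrCA mulrA.
rewrite !qE /eta; case: split => a.
  apply/eqP; rewrite subr_eq0; apply/eqP; congr (_ * xlift _); apply/mnmP => l.
  by rewrite !mnmDE addnACA [X in (X + _)%N]addnC addnACA.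
by rewrite !addmA [(U_(iz) + U_(iy))%MM]addmC subrr.
Qed.

Lemma yzmono_shift s (a : 'I_n) : s != ix ->
  exists c : 'I_n.+1, (U_(s) + yzmono (n - 1) a)%MM = yzmono n c.
Proof.
move=> sx; have degs : mdeg (U_(s) + yzmono (n - 1) a)%MM = n.
  by rewrite mdegD mdeg1 mdeg_yzmono ?ltn_le1 // add1n n1K.
have [|e ltc] := yzmonoP degs; last by exists (Ordinal ltc).
by rewrite mnmDE mnm1E yzmonoE (negPf sx).
Qed.

(** A row of the first block has a single nonzero entry, on the generator of
    s mu; a row of the second block lists the coefficients of the divided power
    s(nu), which involves only y and z. *)
Lemma sum_yzcoef s i : s != ix -> \sum_j yzcoef s i j *: gens j =
  (if split i is inl a then hdet *: 'X_[U_(s) + yzmono (n - 1) a] else 0)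
  - x * qmap (eta s i).
Proof.
move=> sx; rewrite big_split_ord /=.
rewrite -(splitK i); case: (split i) => [a|b] /=;
  rewrite ?split_lshift ?split_rshift.
  rewrite big1 ?add0r => [|a' _]; last first.
    by rewrite /yzcoef !split_lshift scale0r.
  have [c ec] := yzmono_shift a sx.
  rewrite (bigD1 c) //= big1 ?addr0 => [|b neb].
    rewrite /yzcoef split_lshift split_rshift ec /dmono eqxx scale1r gensB.
    congr (_ - _ * _); apply: eq_qmap => m degm.
    by rewrite /eta split_lshift ec.
  rewrite /yzcoef split_lshift split_rshift ec /dmono eq_yzmono.
  by rewrite (val_eqE c b) eq_sym (negPf neb) scale0r.
rewrite [X in _ + X]big1 ?addr0 => [|b' _]; last first.
  by rewrite /yzcoef !split_rshift scale0r.
rewrite sub0r (@eq_qmap (eta s (rshift n b)) (fun m => \sum_(a < n)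
  dmono k (yzmono n b) (U_(s) + yzmono (n - 1) a)%MM
    * dmono k (yzmono (n - 1) a) m)).
  rewrite qmap_sum mulr_sumr -sumrN; apply: eq_bigr => a _.
  by rewrite /yzcoef split_lshift split_rshift gensA scaleNr scalerAr.
move=> m degm; rewrite (@divpow_yz_expansion (eta s (rshift n b))) //.
  by apply: eq_bigr => a _; rewrite /eta split_rshift.
move=> m' _; rewrite /eta split_rshift /dmono; case: eqP => // e.
move/(congr1 (fun m : 'X_{1..3} => m ix)): e.
by rewrite (yzmonoE n b) addmA [(U_(s) + _)%MM]addmC -addmA mnmDE mnm1E eqxx.
Qed.

(** The x part and the y, z part of a row are opposite multiples of
    x (y q(eta_z) - z q(eta_y)); the two leading terms on the second block
    cancel since y (z mu) = z (y mu). *)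
Lemma syz_gens : syz *m gens_col = 0.
Proof.
apply/matrixP => i j; rewrite !mxE.
have iyx : iy != ix by [].
have izx : iz != ix by [].
transitivity (x * (\sum_j xcoef i j *: gens j)
  + hdet *: (y * (\sum_j yzcoef iz i j *: gens j)
   - z * (\sum_j yzcoef iy i j *: gens j))).
  rewrite !mulr_sumr -sumrB scaler_sumr -big_split /=; apply: eq_bigr => l _.
  rewrite !mxE mulrDl -!scalerAl -!scalerAr mulrBl -!scalerAl;
    congr (_ + _ *: _).
rewrite sum_xcoef !sum_yzcoef //.
set Q1 := qmap _; set Q2 := qmap _.
case: split => [a|b];
  rewrite -scalerAr -scalerDr ?mpolyXD -?scalerAr -?mul_mpolyC; ring.
Qed.

Lemma tr_syz : syz^T = - syz.
Proof.
apply/matrixP => i j; rewrite !mxE.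
have -> : xcoef j i = - xcoef i j.
  by rewrite /xcoef pairing_qmapC [X in _ - X]pairing_qmapC opprB.
have yzC s : yzcoef s j i = - yzcoef s i j.
  by rewrite /yzcoef; case: split => a; case: split => b; rewrite ?opprK ?oppr0.
by rewrite !yzC !scaleNr -opprD scalerN -opprD.
Qed.

(** * Linear syzygies *)

(** Modulo x, the first block of generators vanishes and the second becomes a
    multiple of the monomials of degree n in y, z. *)
Lemma mcoeff_gensA a c : (gens (lshift _ a))@_(yzmono n c) = 0.
Proof.
by rewrite gensA mcoeffXM_eq0 // lep1mP yzmonoE.
Qed.

Lemma mcoeff_gensB b c :
  (gens (rshift _ b))@_(yzmono n c) = hdet * (b == c :> nat)%:R.
Proof.
rewrite gensB mcoeffB mcoeffZ mcoeffX eq_yzmono mcoeffXM_eq0 ?subr0 //.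
by rewrite lep1mP yzmonoE.
Qed.

Lemma mulx_inj : injective ( *%R x).
Proof.
move=> f g fg; apply/mpolyP => m.
by rewrite -(mcoeffXM f U_(ix)%MM) -(mcoeffXM g U_(ix)%MM) fg.
Qed.

Lemma gens_free (s : 'I_(n + n.+1) -> k) :
  \sum_j s j *: gens j = 0 -> forall j, s j = 0.
Proof.
rewrite big_split_ord /= => s0.
have sB b : s (rshift n b) = 0.
  move/(congr1 (mcoeff (yzmono n b))): s0.
  rewrite mcoeffD !raddf_sum /= big1 ?add0r => [|a _]; last first.
    by rewrite mcoeffZ mcoeff_gensA mulr0.
  rewrite (bigD1 b) //= mcoeffZ mcoeff_gensB eqxx mulr1 big1 => [|b' neb].
    by move/eqP; rewrite addr0 mcoeff0 mulf_eq0 (negPf hdet_neq0) orbF => /eqP.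
  by rewrite mcoeffZ mcoeff_gensB val_eqE (negPf neb) !mulr0.
move: s0; rewrite [X in _ + X]big1 ?addr0 => [s0|b _];
  last by rewrite sB scale0r.
have {}s0 : \sum_a s (lshift _ a) *: qmap (dmono k (yzmono (n - 1) a)) = 0.
  apply: mulx_inj; rewrite mulr0 -[RHS]s0 mulr_sumr.
  by apply: eq_bigr => a _; rewrite gensA scalerAr.
move=> j; rewrite -(splitK j); case: (split j) => [a|b] /=; last exact: sB.
(* Contracting with phi turns q(nu) into a multiple of nu. *)
move/(congr1 (fun f => pairing (f * 'X_[yzmono (n - 1) a]) phi)): s0.
rewrite mul0r pairing0 mulr_suml pairing_sum (bigD1 a) //= big1 => [|a' nea].
  rewrite addr0 -scalerAl pairingZ qmapP ?mdeg_yzmono ?ltn_le1 // /dmono eqxx.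
  by move/eqP; rewrite mulr1 mulf_eq0 (negPf hdet_neq0) orbF => /eqP.
rewrite -scalerAl pairingZ qmapP ?mdeg_yzmono ?ltn_le1 // /dmono eq_yzmono.
by rewrite val_eqE eq_sym (negPf nea) !mulr0.
Qed.

Lemma linear_form f : f \is 1.-homog ->
  f = f@_U_(ix) *: x + f@_U_(iy) *: y + f@_U_(iz) *: z.
Proof.
move=> homf; apply/mpolyP => m; rewrite !mcoeffD !mcoeffZ !mcoeffX.
have [degm|] := eqVneq (mdeg m) 1%N; last first.
  move=> degm; rewrite (mcoeff_homog_eq0 homf degm).
  by do 3!(case: eqP => [em|_]; first by rewrite -em mdeg1 in degm);
    rewrite !mulr0 !addr0.
have /mdeg1P[[[|[|[|//]]] lti] /eqP->] : mdeg m == 1%N by rewrite degm.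
- rewrite (_ : Ordinal lti = ix); last exact: val_inj.
  by rewrite !eq_mnm1 /= ?eqxx mulr1 !mulr0 !addr0.
- rewrite (_ : Ordinal lti = iy); last exact: val_inj.
  by rewrite !eq_mnm1 /= ?eqxx mulr1 !mulr0 addr0 add0r.
- rewrite (_ : Ordinal lti = iz); last exact: val_inj.
  by rewrite !eq_mnm1 /= ?eqxx mulr1 !mulr0 !add0r.
Qed.

Lemma syz_linear i j : syz i j \is 1.-homog.
Proof.
have homU s : ('X_s : S) \is 1.-homog by rewrite dhomogX /= mdeg1.
by rewrite mxE; apply: rpredD; last (apply: rpredZ; apply: rpredB);
  apply: rpredZ.
Qed.

Lemma mcoeff_syz i j : ((syz i j)@_U_(iy) = hdet * yzcoef iz i j)
  * ((syz i j)@_U_(iz) = - (hdet * yzcoef iy i j)).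
Proof.
rewrite mxE !mcoeffD !mcoeffZ !mcoeffB !mcoeffZ !mcoeffX !eq_mnm1 /=.
by split; rewrite !mulr0 ?mulr1 ?subr0 ?add0r ?sub0r // mulrN.
Qed.

(** Extending a finite family by 0 to all indices makes the relations between
    consecutive coefficients uniform at both ends. *)
Definition extend0 p (h : 'I_p -> k) (c : nat) : k :=
  \sum_(a < p) h a * (a == c :> nat)%:R.

Lemma extend0_val p (h : 'I_p -> k) (a : 'I_p) : extend0 h a = h a.
Proof.
rewrite /extend0 (bigD1 a) //= eqxx mulr1 big1 ?addr0 // => a' nea.
by rewrite val_eqE (negPf nea) mulr0.
Qed.

Lemma extend0_out p (h : 'I_p -> k) c : (p <= c)%N -> extend0 h c = 0.
Proof.
move=> lepc; rewrite /extend0 big1 // => a _; case: eqP => [ea|_];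
  rewrite ?mulr0 //.
by move: (ltn_ord a); rewrite ea ltnNge lepc.
Qed.

Lemma mcoeff_linear_mul0 f g : f \is 1.-homog ->
  (f * g)@_(yzmono n.+1 0) = f@_U_(iy) * g@_(yzmono n 0).
Proof.
move=> homf; rewrite {1}(linear_form homf) !mulrDl -!scalerAl !mcoeffD !mcoeffZ.
rewrite [(x * g)@__]mcoeffXM_eq0 ?lep1mP ?yzmonoE // mulr0 add0r.
rewrite [(z * g)@__]mcoeffXM_eq0 ?lep1mP ?yzmonoE // mulr0 addr0.
by rewrite -addUy_yzmono // mcoeffXM.
Qed.

Lemma mcoeff_linear_mulS f g (c : nat) : f \is 1.-homog -> g \is n.-homog ->
  (c <= n)%N -> (f * g)@_(yzmono n.+1 c.+1) =
    f@_U_(iy) * g@_(yzmono n c.+1) + f@_U_(iz) * g@_(yzmono n c).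
Proof.
move=> homf homg; rewrite leq_eqVlt => lecn.
rewrite {1}(linear_form homf) !mulrDl -!scalerAl !mcoeffD !mcoeffZ.
rewrite [(x * g)@__]mcoeffXM_eq0 ?lep1mP ?yzmonoE // mulr0 add0r.
rewrite -[in (z * g)@__]addUz_yzmono mcoeffXM; congr (_ * _ + _).
(* For c = n the index c.+1 is out of range: both sides vanish. *)
case/orP: lecn => [/eqP->|ltcn]; last by rewrite -addUy_yzmono // mcoeffXM.
rewrite mcoeffXM_eq0 ?lep1mP ?yzmonoE ?subnn // (mcoeff_homog_eq0 homg) //.
by rewrite mdeg3 !yzmonoE subnS subnn !add0n gtn_eqF.
Qed.

Definition coefA (v : 'rV[S]_(n + n.+1)) s :=
  extend0 (fun a => (v 0 (lshift n.+1 a))@_U_(s)).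
Definition coefB (v : 'rV[S]_(n + n.+1)) s :=
  extend0 (fun b => (v 0 (rshift n b))@_U_(s)).

Section LinearSyzygy.
Variable v : 'rV[S]_(n + n.+1).
Hypothesis v_homog : forall j, v 0 j \is 1.-homog.
Hypothesis v_gens : v *m gens_col = 0.

Lemma sum_v_gens : \sum_j v 0 j * gens j = 0.
Proof.
move/matrixP/(_ 0 0): v_gens; rewrite !mxE => vg; rewrite -[RHS]vg.
by apply: eq_bigr => j _; rewrite mxE.
Qed.

Let sum_gens_yz s c :
  \sum_j (v 0 j)@_U_(s) * (gens j)@_(yzmono n c) = hdet * coefB v s c.
Proof.
rewrite big_split_ord /= big1 ?add0r => [|a _];
  last by rewrite mcoeff_gensA mulr0.
by rewrite mulr_sumr; apply: eq_bigr => b _; rewrite mcoeff_gensB mulrCA.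
Qed.

(** The next two lemmas read the syzygy modulo x, where it relates consecutive
    monomials y^(n-c) z^c. *)
Lemma syz_mod_x0 : coefB v iy 0 = 0.
Proof.
move/(congr1 (mcoeff (yzmono n.+1 0))): sum_v_gens.
rewrite raddf_sum /= mcoeff0; under eq_bigr do rewrite mcoeff_linear_mul0 //.
by rewrite sum_gens_yz => /eqP; rewrite mulf_eq0 (negPf hdet_neq0) => /eqP.
Qed.

Lemma syz_mod_xS c : (c <= n)%N -> coefB v iy c.+1 = - coefB v iz c.
Proof.
move=> lecn; move/(congr1 (mcoeff (yzmono n.+1 c.+1))): sum_v_gens.
rewrite raddf_sum /= mcoeff0.
under eq_bigr do rewrite mcoeff_linear_mulS ?gens_homog //.
rewrite big_split /= !sum_gens_yz -mulrDr => /eqP.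
by rewrite mulf_eq0 (negPf hdet_neq0) addr_eq0 => /eqP.
Qed.

(** Once the second block carries only multiples of x, the syzygy can be divided
    by x; contracting it with phi then kills the second block and turns q(nu)
    into nu. *)
Lemma syz_contract (c : nat) :
  (forall s b, s != ix -> (v 0 (rshift n b))@_U_(s) = 0) ->
  (c <= n - 2)%N -> coefA v iy c + coefA v iz c.+1 = 0.
Proof.
move=> vB0 lecn.
have s0 : \sum_a v 0 (lshift _ a) * qmap (dmono k (yzmono (n - 1) a))
    + \sum_b (v 0 (rshift n b))@_U_(ix) *: gens (rshift n b) = 0.
  apply: mulx_inj; rewrite mulr0 -[RHS]sum_v_gens big_split_ord mulrDr
    !mulr_sumr /=.
  congr (_ + _); apply: eq_bigr => j _; first by rewrite gensA mulrCA.
  rewrite {2}(linear_form (v_homog _)) (vB0 iy) // (vB0 iz) // !scale0r !addr0.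
  by rewrite -scalerAr -scalerAl.
move/(congr1 (fun f => pairing (f * 'X_[yzmono (n - 2) c]) phi)): s0.
rewrite mul0r pairing0 mulrDl pairingD !mulr_suml !pairing_sum.
rewrite [X in _ + X]big1 ?addr0 => [|b _]; last first.
  by rewrite -scalerAl pairingZ gens_annihilate ?mulr0 // mdeg_yzmono.
have vq a : pairing (v 0 (lshift _ a) * qmap (dmono k (yzmono (n - 1) a))
      * 'X_[yzmono (n - 2) c]) phi =
    hdet * ((v 0 (lshift _ a))@_U_(iy) * (a == c :> nat)%:R
      + (v 0 (lshift _ a))@_U_(iz) * (a == c.+1 :> nat)%:R).
  have sq s : pairing ('X_s * qmap (dmono k (yzmono (n - 1) a))
      * 'X_[yzmono (n - 2) c]) phi =
    hdet * dmono k (yzmono (n - 1) a) (U_(s) + yzmono (n - 2) c)%MM.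
    rewrite -qmapP; last by rewrite mdegD mdeg1 mdeg_yzmono // add1n n2K.
    by rewrite mpolyXD mulrCA mulrA.
  rewrite {1}(linear_form (v_homog (lshift _ a))) !mulrDl !pairingD -!scalerAl
    !pairingZ !sq.
  rewrite {1}/dmono; case: eqP => [/(congr1 (fun m : 'X_{1..3} => m ix))|_].
    by rewrite mnmDE mnm1E !yzmonoE.
  rewrite !mulr0 add0r addUy_yzmono // addUz_yzmono n2K /dmono !eq_yzmono.
  rewrite !(eq_sym (_ : nat) (a : nat)) mulrDr; congr (_ + _); ring.
under eq_bigr do rewrite vq.
rewrite -mulr_sumr big_split => /eqP.
by rewrite mulf_eq0 (negPf hdet_neq0) => /eqP.
Qed.

End LinearSyzygy.

Lemma ord3_neq_ix (s : 'I_3) : s != ix -> s = iy \/ s = iz.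
Proof.
by case: s => [[|[|[|//]]] lts] // _; [left|right]; apply: val_inj.
Qed.

Definition scalar_row (u : 'I_(n + n.+1) -> k) : 'rV[S]_(n + n.+1) :=
  \row_i (u i)%:MP.

Lemma sub_syz_homog (v : 'rV[S]_(n + n.+1)) u :
  (forall j, v 0 j \is 1.-homog) ->
  forall j, (v - scalar_row u *m syz) 0 j \is 1.-homog.
Proof.
move=> homv j; rewrite !mxE; apply: rpredB => //; apply: rpred_sum => i _.
by rewrite mxE mul_mpolyC; apply/rpredZ/syz_linear.
Qed.

Lemma sub_syz_gens (v : 'rV[S]_(n + n.+1)) w :
  v *m gens_col = 0 -> (v - w *m syz) *m gens_col = 0.
Proof. by move=> vg; rewrite mulmxBl vg -mulmxA syz_gens mulmx0 subr0. Qed.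

Lemma mcoeff_sub_syz (v : 'rV[S]_(n + n.+1)) u s j :
  ((v - scalar_row u *m syz) 0 j)@_U_(s) =
  (v 0 j)@_U_(s) - \sum_i u i * (syz i j)@_U_(s).
Proof.
rewrite mxE mcoeffD [(- (_ *m _)) 0 j]mxE mcoeffN mxE raddf_sum /=;
  congr (_ - _).
by apply: eq_bigr => i _; rewrite mxE mul_mpolyC mcoeffZ.
Qed.

Lemma yzcoefAB s a b : yzcoef s (lshift n.+1 a) (rshift n b) =
  dmono k (yzmono n b) (U_(s) + yzmono (n - 1) a)%MM.
Proof. by rewrite /yzcoef split_lshift split_rshift. Qed.

Lemma yzcoefBA s a b : yzcoef s (rshift n b) (lshift n.+1 a) =
  - dmono k (yzmono n b) (U_(s) + yzmono (n - 1) a)%MM.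
Proof. by rewrite /yzcoef split_lshift split_rshift. Qed.

Lemma yzcoefBB s b b' : yzcoef s (rshift n b) (rshift n b') = 0.
Proof. by rewrite /yzcoef !split_rshift. Qed.

Lemma dmono_addUy (a : 'I_n) c :
  dmono k (yzmono n c) (U_(iy) + yzmono (n - 1) a)%MM = (a == c :> nat)%:R.
Proof. by rewrite addUy_yzmono ?ltn_le1 // n1K /dmono eq_yzmono. Qed.

Lemma dmono_addUz (a : 'I_n) c :
  dmono k (yzmono n c) (U_(iz) + yzmono (n - 1) a)%MM = (a.+1 == c :> nat)%:R.
Proof. by rewrite addUz_yzmono n1K /dmono eq_yzmono. Qed.

(** The rows of the first block are, modulo x, the relations
    y (y^(n-c-1) z^(c+1)) - z (y^(n-c) z^c), which generate the linear syzygies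
    of these monomials. *)
Lemma linear_syz_mod_x (v : 'rV[S]_(n + n.+1)) :
  (forall j, v 0 j \is 1.-homog) -> v *m gens_col = 0 ->
  exists u, forall s b, s != ix ->
    ((v - scalar_row u *m syz) 0 (rshift n b))@_U_(s) = 0.
Proof.
move=> homv vg.
pose vB := coefB v.
have vB_y0 : vB iy 0 = 0 := syz_mod_x0 homv vg.
have vB_yS c : (c <= n)%N -> vB iy c.+1 = - vB iz c.
  exact: syz_mod_xS.
exists (fun i => if split i is inl a then - hdet^-1 * vB iz a else 0) => s b sx.
rewrite mcoeff_sub_syz -(extend0_val (fun b =>
  (v 0 (rshift n b))@_U_(s))) -/(coefB v s) -/vB.
rewrite big_split_ord /= [X in _ - (_ + X)]big1 ?addr0 => [|b' _]; last first.
  by rewrite split_rshift mul0r.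
have uE (a : 'I_n) t : - hdet^-1 * vB iz a * (hdet * t) = - (vB iz a * t).
  by rewrite !mulNr mulrACA mulVf ?hdet_neq0 // mul1r.
under eq_bigr do rewrite split_lshift.
case: (ord3_neq_ix sx) => ->.
  under eq_bigr do rewrite mcoeff_syz yzcoefAB dmono_addUz uE.
  rewrite sumrN opprK; case: (val b) (ltn_ord b) => [|c] ltc.
    by rewrite vB_y0 add0r big1 // => a _; rewrite mulr0.
  have := extend0_val (fun a : 'I_n => vB iz a) (@Ordinal n c ltc).
  by rewrite (vB_yS c (ltnW ltc)) /extend0 /= => ->; rewrite addNr.
under eq_bigr do rewrite mcoeff_syz yzcoefAB dmono_addUy mulrN uE opprK.
have [ltbn|lenb] := ltnP b n.
  by rewrite -[X in X - _](extend0_val (fun a : 'I_n =>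
    vB iz a) (Ordinal ltbn)) subrr.
have eb : b = n :> nat by apply/eqP; rewrite eqn_leq lenb -ltnS ltn_ord.
have -> : \sum_(a < n) vB iz a * (a == b :> nat)%:R = 0.
  exact: (@extend0_out _ (fun a : 'I_n => vB iz a)).
by rewrite subr0 eb; apply/eqP;
  rewrite -oppr_eq0 -vB_yS // /vB /coefB extend0_out.
Qed.

(** The rows of the second block do not disturb the y and z coefficients of the
    second block itself, so they can be used to clear those of the first. *)
Lemma linear_syz_yz (v : 'rV[S]_(n + n.+1)) :
  (forall j, v 0 j \is 1.-homog) -> v *m gens_col = 0 ->
  (forall s b, s != ix -> (v 0 (rshift n b))@_U_(s) = 0) ->
  exists u, forall s j, s != ix -> ((v - scalar_row u *m syz) 0 j)@_U_(s) = 0.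
Proof.
move=> homv vg vB0.
pose vA := coefA v.
have vA_yz c : (c <= n - 2)%N -> vA iy c + vA iz c.+1 = 0.
  exact: syz_contract.
(* The column of index a of the first block forces the row of index a.+1
   through its y coefficient; row 0 is only seen by a z coefficient. *)
pose t (c : nat) := if c is c'.+1 then - vA iy c' else vA iz 0.
exists (fun i => if split i is inr b then hdet^-1 * t b else 0) => s j sx.
rewrite mcoeff_sub_syz big_split_ord /= big1 ?add0r => [|a _]; last first.
  by rewrite split_lshift mul0r.
under eq_bigr do rewrite split_rshift.
rewrite -(splitK j); case: (split j) => [a|b] /=; last first.
  rewrite vB0 // sub0r big1 ?oppr0 // => b' _.
  by case: (ord3_neq_ix sx) => ->; rewrite mcoeff_syz yzcoefBB !(mulr0, oppr0).
have uE c r : hdet^-1 * t c * (hdet * r) = t c * r.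
  by rewrite mulrACA mulVf ?hdet_neq0 // mul1r.
rewrite -(extend0_val (fun a =>
  (v 0 (lshift n.+1 a))@_U_(s))) -/(coefA v s) -/vA.
have sumt c (ltc : (c < n.+1)%N) :
    \sum_(b < n.+1) t b * (c == b :> nat)%:R = t c.
  rewrite -[RHS](extend0_val (fun b : 'I_n.+1 => t b) (Ordinal ltc)).
  by apply: eq_bigr => b _; rewrite eq_sym.
case: (ord3_neq_ix sx) => ->.
  under eq_bigr do rewrite mcoeff_syz yzcoefBA dmono_addUz mulrN mulrN uE.
  by rewrite sumrN opprK sumt ?ltnS // subrr.
under eq_bigr do rewrite mcoeff_syz yzcoefBA dmono_addUy !mulrN opprK uE.
rewrite sumt ?leqW //; case: (val a) (ltn_ord a) => [|c] ltc;
  first by rewrite subrr.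
rewrite /= opprK addrC vA_yz //.
by rewrite -ltnS n2K -ltnS n1K.
Qed.

Lemma linear_syz (v : 'rV[S]_(n + n.+1)) :
  (forall j, v 0 j \is 1.-homog) -> v *m gens_col = 0 ->
  exists w, v = w *m syz.
Proof.
move=> homv vg; have [u1 v1B] := linear_syz_mod_x homv vg.
have [u2] := linear_syz_yz (sub_syz_homog u1 homv) (sub_syz_gens _ vg) v1B.
set w1 := scalar_row u1 in v1B *; set w2 := scalar_row u2; set v2 := v - _ - _.
move=> v2yz; exists (w1 + w2); rewrite mulmxDl; apply/eqP.
rewrite -subr_eq0 opprD addrA -/v2; apply/eqP/rowP => j; rewrite [RHS]mxE.
have homv2 : forall j, v2 0 j \is 1.-homog by do 2!apply: sub_syz_homog.
have v2E i : v2 0 i = (v2 0 i)@_U_(ix) *: x.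
  by rewrite {1}(linear_form (homv2 i)) (v2yz iy) // (v2yz iz) // !scale0r
    !addr0.
rewrite v2E (@gens_free (fun i => (v2 0 i)@_U_(ix))) ?scale0r //.
apply: mulx_inj; rewrite mulr0 mulr_sumr.
have v2g : v2 *m gens_col = 0 by do 2!apply: sub_syz_gens.
rewrite -[RHS](sum_v_gens v2g); apply: eq_bigr => i _.
by rewrite [in RHS]v2E -scalerAr -scalerAl.
Qed.

End InverseSystem.

(** * Exactness for a skew-symmetric matrix *)

(** The Koszul relations between the g_j are in the row space of M, and pairing
    v with them through the skew-symmetric M gives v_i g_j =
      v_j g_i.  The elements a and b stand for a
    regular sequence in the ideal of the g_j. *)
Lemma skew_exact (R : idomainType) r (M : 'M[R]_r) (g : 'cV[R]_r) (a b : R)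
    (ca cb : 'rV[R]_r) :
  M^T = - M ->
  (forall v : 'rV_r, v *m g = 0 -> exists w, v = w *m M) ->
  ca *m g = a%:M -> cb *m g = b%:M ->
  a != 0 -> (forall u u', a * u' = b * u -> exists w, u = a * w) ->
  forall v, v *m M = 0 -> exists w : 'rV_1, v = w *m g^T.
Proof.
move=> skewM exM cag cbg a0 regab v vM.
have proportional i j : v 0 i * g j 0 = v 0 j * g i 0.
  (* The Koszul relation between g_i and g_j. *)
  pose c := g j 0 *: delta_mx 0 i - g i 0 *: delta_mx 0 j : 'rV[R]_r.
  have [|w cw] := exM c.
    rewrite mulmxBl -!scalemxAl -!rowE; apply/rowP => l.
    by rewrite ord1 !mxE mulrC subrr.
  have: v *m c^T = 0.
    by rewrite cw trmx_mul skewM mulmxA mulmxN vM oppr0 mul0mx.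
  rewrite /c linearB !linearZ /= !trmx_delta mulmxDr -!scalemxAr mulmxN -!colE.
  move/matrixP/(_ 0 0); rewrite !mxE => /eqP; rewrite mulrN subr_eq0 => /eqP.
  by rewrite ![_ * v 0 _]mulrC.
(* If e = sum_j c_j g_j, then e v is the multiple of g by sum_j c_j v_j. *)
have multiple c e : c *m g = e%:M ->
  forall i, e * v 0 i = (c *m v^T) 0 0 * g i 0.
  move=> cg i; move/matrixP/(_ 0 0): cg; rewrite !mxE eqxx mulr1n => <-.
  rewrite !mulr_suml; apply: eq_bigr => j _.
  by rewrite -mulrA [g j 0 * _]mulrC proportional mxE mulrA.
have := multiple _ _ cag; have := multiple _ _ cbg.
set ub := (cb *m _) 0 0; set ua := (ca *m _) 0 0 => vb va.
have [i gi0] : exists i, g i 0 != 0.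
  apply/existsP; apply: contraNT a0; rewrite negb_exists => /forallP g0.
  move/matrixP/(_ 0 0): cag; rewrite !mxE eqxx mulr1n => <-.
  by rewrite big1 // => j _; move: (g0 j); rewrite negbK => /eqP->;
    rewrite mulr0.
have [|w uaE] := regab ua ub.
  by apply: (mulIf gi0); rewrite -!mulrA -vb -va mulrCA.
exists w%:M; rewrite mul_scalar_mx; apply/rowP => j; rewrite !mxE.
by apply: (mulfI a0); rewrite va uaE mulrA.
Qed.

(** * Substituting the coefficients of the inverse system *)

Section Specialization.
Variables (k : fieldType) (n : nat) (alpha : mono (2 * n - 2) -> k).
Local Notation S := {mpoly k[3]}.
Local Notation RR := (Rring n).
Local Notation sp := (@specialize n k alpha).
Local Notation phi := (divpow_of alpha).

HB.instance Definition _ :=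
  GRing.RMorphism.copy (@specialize n k alpha) (@specialize n k alpha).

Lemma specialize_Xvar i : sp (Xvar n i) = 'X_i.
Proof. by rewrite /specialize mmapX mmap1U split_lshift. Qed.

Lemma specialize_tvar u : sp (tvar u) = (alpha u)%:MP.
Proof. by rewrite /specialize mmapX mmap1U split_rshift enum_rankK. Qed.

Lemma divpow_ofE m (u : mono (2 * n - 2)) : mval u = m -> phi m = alpha u.
Proof.
move=> <-; rewrite /divpow_of (bigD1 u) //= /dmono eqxx mulr1 big1 ?addr0 //
  => v nev.
by rewrite (inj_eq (@mval_inj _)) eq_sym (negPf nev) mulr0.
Qed.

Lemma divpow_of_eq0 m : mdeg m != (2 * n - 2)%N -> phi m = 0.
Proof.
move=> degm; rewrite /divpow_of big1 // => u _; rewrite /dmono.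
by case: eqP => [em|_]; rewrite ?mulr0 //; rewrite em mdeg_mval eqxx in degm.
Qed.

(** The values of the divided powers involved are polynomials in the t_m only,
    so they specialize to constants. *)
Definition specializes (nu : divpow RR) (nu' : divpow k) :=
  forall m, sp (nu m) = (nu' m)%:MP.

Lemma specializes_dmono m : specializes (dmono RR m) (dmono k m).
Proof. by move=> m'; rewrite /dmono rmorph_nat mpolyC_nat. Qed.

Lemma specializes_Phi : specializes (Phi n) phi.
Proof.
move=> m; rewrite /Phi /divpow_of !rmorph_sum; apply: eq_bigr => u _.
by rewrite rmorphM /= specialize_tvar specializes_dmono mpolyCM.
Qed.

Lemma specializes_Phit : specializes (Phit n) (xlift phi).
Proof.
move=> m; have [mx0|mx] := eqVneq (m ix) 0%N.
  rewrite xlift_eq0 // mpolyC0 /Phit big1 ?rmorph0 // => u _; rewrite /dmono.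
  case: eqP => [/(congr1 (fun m : 'X_{1..3} => m ix))|_]; last by rewrite mulr0.
  by rewrite mx0 mnmDE mnm1E.
rewrite -lep1mP in mx; rewrite -(submK mx) addmC xliftE -specializes_Phi.
congr (sp _); apply: eq_bigr => u _; congr (_ * _).
by rewrite /dmono eqm_add2l.
Qed.

Lemma specializes_zero (nu : divpow RR) :
  (forall m, nu m = 0) -> specializes nu (dzero k).
Proof. by move=> nu0 m; rewrite nu0 rmorph0 mpolyC0. Qed.

Lemma map_specialize_T : map_mx sp (T n) = map_mx (@mpolyC 3 k) (hankel n phi).
Proof. by apply/matrixP => i j; rewrite !mxE specializes_Phi. Qed.

Lemma specialize_delta : sp (delta n) = (hdet n phi)%:MP.
Proof. by rewrite -!det_map_mx map_specialize_T. Qed.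

Lemma specialize_Q i j : sp (Q n i j) = ((\adj (hankel n phi)) i j)%:MP.
Proof.
have := congr1 (fun A : 'M_ _ => A i j) (map_mx_adj sp (T n)).
by rewrite map_specialize_T -map_mx_adj !mxE.
Qed.

Lemma specialize_PsiX m : sp (Psi 'X_[m]) = 'X_[m].
Proof.
rewrite /Psi mevalX rmorph_prod [RHS]mpolyXE_id; apply: eq_bigr => i _.
by rewrite rmorphXn /= specialize_Xvar.
Qed.

Lemma specialize_Psi_q nu nu' : specializes nu nu' ->
  sp (Psi (q nu)) = qmap n phi nu'.
Proof.
move=> spnu; rewrite /Psi /q /qmap [meval _ _]raddf_sum rmorph_sum;
  apply: eq_bigr => j _.
rewrite /= mevalZ rmorphM /= spnu mul_mpolyC; congr (_ *: _).
rewrite [meval _ _]raddf_sum rmorph_sum; apply: eq_bigr => i _.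
by rewrite /= mevalZ rmorphM /= specialize_Q -/(Psi _) specialize_PsiX
  mul_mpolyC.
Qed.

Lemma specialize_QQ nu1 nu1' nu2 nu2' :
  specializes nu1 nu1' -> specializes nu2 nu2' ->
  sp (QQ nu1 nu2) = (pairing (qmap n phi nu1') nu2')%:MP.
Proof.
move=> sp1 sp2; rewrite /QQ pairing_mx_comb pairing_qmap.
rewrite !rmorph_sum; apply: eq_bigr => j _.
rewrite !rmorph_sum; apply: eq_bigr => i _.
by rewrite !rmorphM /= sp1 sp2 specialize_Q.
Qed.

Lemma qmap_dzero : qmap n phi (dzero k) = 0.
Proof. by rewrite /qmap big1 // => j _; rewrite /dzero scale0r. Qed.

Lemma pairing_dzero (K : comNzRingType) (f : {mpoly K[3]}) :
  pairing f (dzero K) = 0.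
Proof. by rewrite /pairing big1 // => m _; rewrite mulr0. Qed.

Lemma Psi0 : Psi (0 : {mpoly RR[3]}) = 0.
Proof. exact: meval0. Qed.

Lemma specialize_bb1 nu mu nu' rho : specializes nu nu' ->
  specializes (contract mu (Phit n)) rho ->
  sp (bb1 (nu, mu)) = 'X_ix * qmap n phi nu'
    + (hdet n phi *: sp (Psi mu) - 'X_ix * qmap n phi rho).
Proof.
move=> spnu sprho.
have spE (a b c d e : RR) : sp (a * b + (c * d - a * e)) =
    sp a * sp b + (sp c * sp d - sp a * sp e).
  by rewrite rmorphD rmorphB !rmorphM.
rewrite /bb1 spE specialize_PsiX specialize_delta mul_mpolyC.
by congr (_ * _ + (_ - _ * _)); exact: specialize_Psi_q.
Qed.

Lemma specialize_d1 i : sp (bb1 (@basis1 n i)) = gens phi i.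
Proof.
rewrite /basis1 /gens; case: split => [a|b].
  rewrite (specialize_bb1 (specializes_dmono _) (rho := dzero k)).
    by rewrite Psi0 rmorph0 qmap_dzero scaler0 mulr0 subr0 addr0.
  by apply: specializes_zero => m; rewrite contractE mul0r pairing0.
rewrite (specialize_bb1 (specializes_zero (nu := dzero RR) _)
  (rho := fun m => xlift phi (yzmono n b + m)%MM)) //.
  by rewrite qmap_dzero mulr0 add0r specialize_PsiX.
by move=> m; rewrite contractX specializes_Phit.
Qed.

Let pair nu nu' := pairing (qmap n phi nu) nu'.

Lemma specialize_beta nu1 nu1' nu2 nu2' nu3 nu3' nu4 nu4' :
  specializes nu1 nu1' -> specializes nu2 nu2' ->
  specializes nu3 nu3' -> specializes nu4 nu4' ->
  sp (Psi 'X_ix * (QQ nu1 nu2 - QQ nu3 nu4)) =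
  (pair nu1' nu2' - pair nu3' nu4') *: 'X_ix.
Proof.
move=> sp1 sp2 sp3 sp4.
have spE (a b c : RR) : sp (a * (b - c)) = sp a * (sp b - sp c).
  by rewrite rmorphM rmorphB.
rewrite spE specialize_PsiX (specialize_QQ sp1 sp2) (specialize_QQ sp3 sp4).
by rewrite -mpolyCB mulrC mul_mpolyC.
Qed.

(** By bilinearity and symmetry of the form defined by q, the four terms in
    beta_1, beta_2, beta_3 assemble into one expression in the sums E, E'. *)
Lemma specialize_bb (mu mu' : {mpoly RR[3]}) nu nu'
    (A B A' B' : 'I_3 -> divpow k) :
  (forall s, specializes (contract ('X_s * mu) (Phit n)) (A s)) ->
  (forall s, specializes (contract ('X_s * mu') (Phit n)) (A' s)) ->
  (forall s, specializes (contract 'X_s nu) (B s)) ->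
  (forall s, specializes (contract 'X_s nu') (B' s)) ->
  let E s m := A s m + B s m in let E' s m := A' s m + B' s m in
  let P s := sp (pairing ('X_s * mu) nu') - sp (pairing ('X_s * mu') nu) in
  sp (bb (mu, nu) (mu', nu')) =
    (pair (E iz) (E' iy) - pair (E iy) (E' iz)) *: 'X_ix
    + hdet n phi *: ('X_iy * P iz - 'X_iz * P iy).
Proof.
move=> spA spA' spB spB' E E' P.
(* Stated for variables: matching the laws of ring morphisms against the forms
   themselves would unfold the adjoint matrix. *)
have spE (b3 b2 b2' b1 y z d p1 p2 p3 p4 : RR) :
    sp (b3 + b2 - b2' + b1 + y * d * (p1 - p2) - z * d * (p3 - p4)) =
    sp b3 + sp b2 - sp b2' + sp b1
    + sp d * (sp y * (sp p1 - sp p2) - sp z * (sp p3 - sp p4)).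
  have regroup (R : comNzRingType) (c u w e f g : R) :
    c + u * e * f - w * e * g = c + e * (u * f - w * g) by ring.
  by rewrite -regroup !(rmorphD, rmorphN) !rmorphM !(rmorphD, rmorphN).
rewrite /bb spE !specialize_PsiX specialize_delta mul_mpolyC; congr (_ + _).
transitivity (
    (pair (A iz) (A' iy) - pair (A iy) (A' iz)) *: 'X_ix
    + (pair (A iz) (B' iy) - pair (A iy) (B' iz)) *: 'X_ix
    - (pair (A' iz) (B iy) - pair (A' iy) (B iz)) *: 'X_ix
    + (pair (B iz) (B' iy) - pair (B iy) (B' iz)) *: 'X_ix : S).
  by congr (_ + _ - _ + _); exact: specialize_beta.
rewrite -!scalerDl -scalerBl -scalerDl; congr (_ *: _).
have pairD s s' : pair (E s) (E' s') = pair (A s) (A' s') + pair (A s) (B' s')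
    + (pair (A' s') (B s) + pair (B s) (B' s')).
  rewrite [pair (A' s') _]pairing_qmapC /pair /E qmapD !pairingD.
  by congr (_ + _); rewrite -big_split; apply: eq_bigr => m _; rewrite mulrDr.
rewrite !pairD; move: (pair _ _) (pair _ _) (pair _ _) (pair _ _) =>
  a1 a2 a3 a4.
by move: (pair _ _) (pair _ _) (pair _ _) (pair _ _) => a5 a6 a7 a8; ring.
Qed.

Lemma specialize_eta i s : exists A B : divpow k,
  [/\ specializes (contract ('X_s * (@basis2 n i).1) (Phit n)) A,
      specializes (contract 'X_s (@basis2 n i).2) B
    & forall m, A m + B m = eta phi s i m].
Proof.
rewrite /basis2 /eta; case: split => [a|b] /=.
  exists (fun m => xlift phi (U_(s) + yzmono (n - 1) a + m)%MM), (dzero k);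
    split.
  - by move=> m; rewrite -mpolyXD contractX specializes_Phit.
  - by apply: specializes_zero => m; rewrite contractE pairing_dzero.
  - by move=> m; rewrite addr0.
exists (dzero k), (fun m => dmono k (yzmono n b) (U_(s) + m)%MM); split.
- by apply: specializes_zero => m; rewrite contractE mulr0 mul0r pairing0.
- by move=> m; rewrite contractX specializes_dmono.
- by move=> m; rewrite add0r.
Qed.

Lemma specialize_pairing i j s :
  sp (pairing ('X_s * (@basis2 n i).1) (@basis2 n j).2)
    - sp (pairing ('X_s * (@basis2 n j).1) (@basis2 n i).2)
  = (yzcoef k s i j)%:MP.
Proof.
have pE (a : 'I_n) (b : 'I_n.+1) :
    sp (pairing ('X_s * 'X_[yzmono (n - 1) a]) (dmono RR (yzmono n b))) =
    (dmono k (yzmono n b) (U_(s) + yzmono (n - 1) a)%MM)%:MP.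
  by rewrite -mpolyXD pairingX specializes_dmono.
have p0r f : sp (pairing f (dzero RR)) = 0 by rewrite pairing_dzero rmorph0.
have p0l nu : sp (pairing ('X_s * 0) nu) = 0 by rewrite mulr0 pairing0 rmorph0.
rewrite /basis2 /yzcoef; case: split => [a|b]; case: split => [a'|b'] /=.
- transitivity (0 - 0 : S); last by rewrite subrr mpolyC0.
  by congr (_ - _); exact: p0r.
- by rewrite pE p0r subr0.
- by rewrite p0l pE sub0r mpolyCN.
- by rewrite p0l p0l subrr mpolyC0.
Qed.

Lemma specialize_d2 i j : sp (bb (@basis2 n i) (@basis2 n j)) = syz n phi i j.
Proof.
have eta_exists l : exists AB : ('I_3 -> divpow k) * ('I_3 -> divpow k),
  [/\ forall s,
        specializes (contract ('X_s * (@basis2 n l).1) (Phit n)) (AB.1 s),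
      forall s, specializes (contract 'X_s (@basis2 n l).2) (AB.2 s)
    & forall s m, AB.1 s m + AB.2 s m = eta phi s l m].
  have [Ax [Bx [? ? ?]]] := specialize_eta l ix.
  have [Ay [By [? ? ?]]] := specialize_eta l iy.
  have [Az [Bz [? ? ?]]] := specialize_eta l iz.
  pose pick T (X Y Z : T) (s : 'I_3) :=
    if s == ix then X else if s == iy then Y else Z.
  have ord3 s : [\/ s = ix, s = iy | s = iz].
    by case: s => [[|[|[|//]]] lts];
      [constructor 1|constructor 2|constructor 3]; apply: val_inj.
  by exists (pick _ Ax Ay Az, pick _ Bx By Bz); split=> s; case: (ord3 s) => ->.
have [[A B] [/= spA spB ABE]] := eta_exists i.
have [[A' B'] [/= spA' spB' ABE']] := eta_exists j.
rewrite [basis2 i]surjective_pairing [basis2 j]surjective_pairing.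
apply: etrans (specialize_bb spA spA' spB spB') _ => /=.
have pairE s s' : pair (fun m => A s m + B s m) (fun m => A' s' m + B' s' m) =
    pair (eta phi s i) (eta phi s' j).
  rewrite /pair (@eq_qmap k n phi _ (eta phi s i) (fun m _ => ABE s m)).
  by apply: eq_bigr => m _; rewrite ABE'.
rewrite mxE; congr (_ *: _ + _ *: _); first by rewrite !pairE.
by congr (_ - _); rewrite specialize_pairing mulrC mul_mpolyC.
Qed.

End Specialization.

(** * Comparison with the assumed resolution *)

Section HomogeneousFactor.
Variable K : comNzRingType.
Local Notation S := {mpoly K[3]}.
Implicit Types (f g : S) (m : 'X_{1..3}).

Lemma mdeg_lem (m m' : 'X_{1..3}) : (m <= m')%MM -> (mdeg m <= mdeg m')%N.
Proof. by move=> le; rewrite -(submK le) mdegD leq_addl. Qed.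

Lemma mcoeff_homogM_le d f g m : g \is d.-homog -> (mdeg m <= d)%N ->
  (f * g)@_m = f@_0%MM * g@_m.
Proof.
move=> /dhomogP homg lemd; rewrite {1}(mpolyE g) mulr_sumr raddf_sum /=.
rewrite [g in RHS]mpolyE [in RHS]raddf_sum /= mulr_sumr !big_seq.
apply: eq_bigr => m' /homg degm'; rewrite -scalerAr !mcoeffZ mcoeffX.
rewrite mulrCA; congr (_ * _); case: eqP => [<-|nem].
  by have := mcoeffXM f m' 0%MM; rewrite addm0 mulrC mulr1.
rewrite mulr0 mulrC mcoeffXM_eq0 //; apply/negP => lem'm.
have em : (m - m')%MM = 0%MM.
  apply/eqP; rewrite -mdeg_eq0 -(eqn_add2r (mdeg m')) -mdegD submK // add0n.
  by rewrite eqn_leq degm' lemd -degm' mdeg_lem.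
by apply: nem; rewrite -[RHS](submK lem'm) em add0m.
Qed.

End HomogeneousFactor.

Section Resolution.
Variables (k : fieldType) (A : comAlgType k) (X : 'I_3 -> A) (n : nat).
Variables (s1 s2 s3 : nat) (alpha : mono (2 * n - 2) -> k).
Local Notation S := {mpoly k[3]}.
Local Notation phi := (divpow_of alpha).
Local Notation pi := (presentation X).
Variables (M1 : 'M[S]_(s1, 1)) (M2 : 'M[S]_(s2, s1)) (M3 : 'M[S]_(s3, s2)).

Hypothesis n_gt1 : (1 < n)%N.
Hypothesis res : pure_resolution pi (Complex3 M1 M2 M3) n n.+1 (2 * n).+1.
Hypothesis pi_ker : forall f : S, pi f = 0 <-> annihilates f phi.

HB.instance Definition _ :=
  GRing.RMorphism.copy (@presentation k A X) (@presentation k A X).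

Lemma pi_ker_homog d (f : S) : f \is d.-homog ->
  (forall m, mdeg m = (2 * n - 2 - d)%N -> pairing (f * 'X_[m]) phi = 0) ->
  (d <= 2 * n - 2)%N -> pi f = 0.
Proof.
move=> homf fphi led; apply/pi_ker => m; rewrite contractE.
have [degm|degm] := eqVneq (mdeg m) (2 * n - 2 - d)%N; first exact: fphi.
rewrite (mpolyE (f * _)) pairing_sum big1_seq // => m' /= fm'.
rewrite pairingZ pairingX divpow_of_eq0 ?mulr0 //.
have /dhomogP/(_ m' fm') -> : f * 'X_[m] \is (d + mdeg m).-homog.
  by apply: homogM; rewrite ?homogX.
by apply: contra degm => /eqP <-; rewrite addKn.
Qed.

Lemma pi_ker_high_degree (f : S) d : f \is d.-homog -> (2 * n - 2 < d)%N ->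
  pi f = 0.
Proof.
move=> /dhomogP homf ltd; apply/pi_ker => m; rewrite contractE.
rewrite (mpolyE f) mulr_suml pairing_sum big1_seq // => m' /= /homf degm'.
rewrite -scalerAl -mpolyXD pairingZ pairingX divpow_of_eq0 ?mulr0 //.
by rewrite mdegD degm' gtn_eqF // ltn_addr.
Qed.

Lemma pi_ker_pairing (f : S) m : pi f = 0 -> pairing (f * 'X_[m]) phi = 0.
Proof. by move=> /pi_ker/(_ m); rewrite contractE. Qed.

Lemma M1_homog i : M1 i 0 \is n.-homog.
Proof.
by apply/dhomogP => m mM; rewrite -[RHS](res_hom1 res mM) addn0.
Qed.

Lemma M1_ker i : pi (M1 i 0) = 0.
Proof.
apply/(res_exact0 res); exists (delta_mx 0 i).
by rewrite -rowE mxE.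
Qed.

Lemma ker_generated f : pi f = 0 ->
  exists v : 'rV_s1, f = \sum_i v 0 i * M1 i 0.
Proof. by move=> /(res_exact0 res)[v <-]; exists v; rewrite mxE. Qed.

(** The ideal is generated by forms of degree n, so it has no nonzero form of
    degree n-1. *)
Lemma ker_low_degree f : f \is (n - 1).-homog ->
  (forall m, mdeg m = (n - 1)%N -> pairing (f * 'X_[m]) phi = 0) -> f = 0.
Proof.
move=> homf fphi.
have [||v ef] := ker_generated (@pi_ker_homog (n - 1) f homf _ _).
- by move=> m degm; apply: fphi; rewrite degm; lia.
- lia.
apply/mpolyP => m; rewrite mcoeff0.
have [degm|] := eqVneq (mdeg m) (n - 1)%N; last exact: mcoeff_homog_eq0.
rewrite ef raddf_sum big1 // => i _ /=.
rewrite (mcoeff_homogM_le _ (M1_homog i)) ?degm ?leq_subr //.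
by rewrite (mcoeff_homog_eq0 (M1_homog i)) ?mulr0 // degm; lia.
Qed.

Let phi_nondeg := ker_low_degree.
Local Notation g := (@gens k n phi).
Local Notation G := (gens_col n phi).
Local Notation B := (syz n phi).
Local Notation del := (hdet n phi).

Lemma gens_ker i : pi (g i) = 0.
Proof.
apply: (pi_ker_homog (gens_homog phi n_gt1 i)); last by lia.
move=> m degm; apply: (gens_annihilate phi n_gt1); rewrite degm; lia.
Qed.

Definition constant_mx p r (C : 'M[k]_(p, r)) : 'M[S]_(p, r) :=
  map_mx (@mpolyC 3 k) C.

Lemma ker_homog_expansion f : f \is n.-homog -> pi f = 0 ->
  f = \sum_j (del^-1 * gcoord phi f j) *: g j.
Proof.
move=> homf f0.
under eq_bigr do rewrite -scalerA.
rewrite -scaler_sumr -(gens_expansion phi_nondeg n_gt1 homf).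
  by rewrite scalerA mulVf ?scale1r // (hdet_neq0 phi_nondeg).
by move=> m _; apply: pi_ker_pairing.
Qed.

Lemma constant_mx_gens r (C : 'M[k]_(r, n + n.+1)) i :
  (constant_mx C *m G) i 0 = \sum_j C i j *: g j.
Proof. by rewrite mxE; apply: eq_bigr => j _; rewrite !mxE mul_mpolyC. Qed.

Lemma M1_from_gens : exists C, M1 = constant_mx C *m G.
Proof.
exists (\matrix_(i, j) (del^-1 * gcoord phi (M1 i 0) j)).
apply/matrixP => i j; rewrite ord1 constant_mx_gens.
rewrite {1}(ker_homog_expansion (M1_homog i) (M1_ker i)).
by apply: eq_bigr => l _; rewrite mxE.
Qed.

(** Each generator has degree n, as do the entries of M1; hence only the
    constant terms of its coefficients matter, and the change of generators is
    given by a scalar matrix. *)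
Lemma gens_from_M1 : exists C, G = constant_mx C *m M1.
Proof.
have gv j : exists c : 'rV[k]_s1, g j = \sum_i c 0 i *: M1 i 0.
  have [v ev] := ker_generated (gens_ker j).
  exists (\row_i (v 0 i)@_0%MM); apply/mpolyP => m.
  (* Both sides are forms of degree n. *)
  have [degm|degm] := eqVneq (mdeg m) n; last first.
    rewrite !(@mcoeff_homog_eq0 _ n) ?(gens_homog phi n_gt1) //.
    by apply: rpred_sum => i _; apply/rpredZ/M1_homog.
  rewrite ev !raddf_sum; apply: eq_bigr => i _ /=.
  by rewrite mcoeffZ mxE (mcoeff_homogM_le _ (M1_homog i)) ?degm.
pose P j (c : 'rV[k]_s1) := g j == \sum_i c 0 i *: M1 i 0.
have exP j : exists c, P j c by have [c ec] := gv j; exists c; rewrite /P -ec.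
exists (\matrix_(j, i) (xchoose (exP j)) 0 i).
apply/matrixP => j l; rewrite ord1 !mxE (eqP (xchooseP (exP j))).
by apply: eq_bigr => i _; rewrite !mxE mul_mpolyC.
Qed.

Lemma gens_exact0 f : pi f = 0 <-> exists v : 'rV_(n + n.+1), (v *m G) 0 0 = f.
Proof.
split=> [/(res_exact0 res)[v <-]|[v <-]].
  by have [C eM1] := M1_from_gens; exists (v *m constant_mx C);
    rewrite -mulmxA -eM1.
rewrite mxE rmorph_sum big1 // => j _; rewrite rmorphM /= mxE gens_ker.
exact: mulr0.
Qed.

(** Both systems of generators differ by scalar matrices C and R with R C = 1,
    by independence of [gens].  A syzygy v of the new generators gives the
    syzygy v R of the old ones, so v = v R C is a combination of the rows of
    M2 C, which are linear syzygies of the new generators. *)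
Lemma syz_exact1 (v : 'rV_(n + n.+1)) : v *m G = 0 <-> exists w, v = w *m B.
Proof.
split=> [vG|[w ->]]; last by rewrite -mulmxA (syz_gens phi_nondeg) ?mulmx0.
have [C eM1] := M1_from_gens; have [R eG] := gens_from_M1.
have RC : R *m C = 1%:M.
  apply/matrixP => i j; apply/eqP; rewrite -subr_eq0; apply/eqP.
  apply: (gens_free phi_nondeg n_gt1 (s := fun j => (R *m C) i j - 1%:M i j)).
  have : (constant_mx (R *m C) *m G) i 0 = g i.
    by rewrite /constant_mx map_mxM -mulmxA -eM1 -eG mxE.
  rewrite constant_mx_gens => gE; under eq_bigr do rewrite scalerBl.
  rewrite sumrB gE (bigD1 i) //= big1 => [|l nel].
    by rewrite mxE eqxx scale1r addr0 subrr.
  by rewrite mxE eq_sym (negPf nel) scale0r.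
have [|w vR] := (res_exact1 res (v *m constant_mx R)).1.
  by rewrite /= -mulmxA -eG.
have M2C_syz i : exists u, row i (M2 *m constant_mx C) = u *m B.
  apply: (linear_syz phi_nondeg n_gt1) => [j|].
    rewrite !mxE; apply: rpred_sum => l _; rewrite mxE mulrC mul_mpolyC.
    apply/rpredZ/dhomogP => m mM2; apply: (@addIn n).
    by rewrite add1n; exact: (res_hom2 res mM2).
  rewrite row_mul -!mulmxA -eM1 -row_mul; apply/matrixP => j l; rewrite !mxE.
  have /matrixP/(_ 0 l) : row i M2 *m M1 = 0.
    by apply/(res_exact1 res); exists (delta_mx 0 i); rewrite rowE.
  by rewrite !mxE => {2}<-; apply: eq_bigr => t _; rewrite !mxE.
have [W eW] : exists W, M2 *m constant_mx C = W *m B.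
  have /fin_all_exists [U eU] := M2C_syz.
  exists (\matrix_i U i); apply/row_matrixP => i.
  by rewrite eU row_mul rowK.
exists (w *m W); rewrite -mulmxA -eW mulmxA -vR -mulmxA.
by rewrite /constant_mx -map_mxM RC map_mx1 mulmx1.
Qed.

(** Powers above the socle degree lie in the ideal. *)
Lemma pure_power_ker i :
  exists c : 'rV_(n + n.+1), c *m G = ('X_[U_(i) *+ (2 * n - 1)])%:M.
Proof.
have [|c ec] := (gens_exact0 'X_[U_(i) *+ (2 * n - 1)]).1.
  apply: (@pi_ker_high_degree _ (2 * n - 1)); last by lia.
  by rewrite dhomogX /= mdegMn mdeg1 mul1n.
exists c; apply/matrixP => l j; rewrite !ord1 ec.
by rewrite !mxE eqxx mulr1n.
Qed.

Lemma pure_powers_regular N (u u' : S) :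
  'X_[U_(ix) *+ N] * u' = 'X_[U_(iy) *+ N] * u ->
  exists w, u = 'X_[U_(ix) *+ N] * w.
Proof.
move=> uu'; have [m' nle|w -> _] := @mpolyX_dvd _ u (U_(ix) *+ N)%MM;
  last by exists w.
rewrite -(mcoeffXM u (U_(iy) *+ N)%MM) -uu' mcoeffXM_eq0 //.
apply: contra nle => /mnm_lepP le; apply/mnm_lepP => i; move: (le i).
rewrite mnmDE !mulmnE !mnm1E; case: eqP => [<-|_]; by rewrite ?mul0n ?add0n.
Qed.

Lemma syz_exact2 (v : 'rV_(n + n.+1)) : v *m B = 0 <->
  exists w : 'rV_1, v = w *m G^T.
Proof.
have [cx cxG] := pure_power_ker ix; have [cy cyG] := pure_power_ker iy.
split=> [|[w ->]].
  apply: (skew_exact (tr_syz _ _) _ cxG cyG).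
  - by move=> u /syz_exact1.
  - by rewrite -msupp_eq0 msuppX.
  - exact: pure_powers_regular.
apply: trmx_inj; rewrite !trmx_mul trmxK tr_syz mulNmx mulmxA.
by rewrite (syz_gens phi_nondeg n_gt1) mul0mx oppr0 trmx0.
Qed.

Lemma gens_exact3 (v : 'rV_1) : v *m G^T = 0 -> v = 0.
Proof.
move=> vG; case: (pickP (fun j => g j != 0)) => [j gj|g0]; last first.
  have : \sum_j (1 : k) *: g j = 0.
    by rewrite big1 // => j _; move/negbFE/eqP: (g0 j) => ->; rewrite scaler0.
  move/(gens_free phi_nondeg n_gt1)/(_ (lshift n.+1 (Ordinal (ltnW
    n_gt1))))/eqP.
  by rewrite oner_eq0.
apply/rowP => l; rewrite ord1 mxE; move/matrixP/(_ 0 j): vG.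
rewrite !mxE big_ord1 !mxE => /eqP; rewrite mulf_eq0 (negPf gj) orbF.
by move/eqP.
Qed.

Lemma homog_minimal d r s (M : 'M[S]_(r, s)) :
  (0 < d)%N -> (forall i j, M i j \is d.-homog) -> minimal_mx M.
Proof.
by move=> d0 homM i j;
  rewrite (mcoeff_homog_eq0 (homM i j)) // mdeg0 neq_ltn d0.
Qed.

Lemma syz_resolution :
  pure_resolution pi (Complex3 G B G^T) n n.+1 (2 * n).+1.
Proof.
have homG i j : G i j \is n.-homog by rewrite mxE gens_homog.
have homB i j : B i j \is 1.-homog by exact: syz_linear.
have homGt i j : G^T i j \is n.-homog by rewrite mxE.
split.
- by move=> i j m /(dhomogP _ _ _ (homG i j)) /= ->; rewrite addn0.
- by move=> i j m /(dhomogP _ _ _ (homB i j)) /= ->.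
- by move=> i j m /(dhomogP _ _ _ (homGt i j)) /= ->; lia.
- exact: homog_minimal (ltnW n_gt1) homG.
- exact: homog_minimal homB.
- exact: homog_minimal (ltnW n_gt1) homGt.
- exact: (res_onto res).
- exact: gens_exact0.
- exact: syz_exact1.
- exact: syz_exact2.
- exact: gens_exact3.
Qed.

End Resolution.

(** * The grading and the socle degree *)

Section GorensteinAlgebra.
Variables (k : fieldType) (A : comAlgType k) (gr : nat -> A -> Prop).
Variables (X : 'I_3 -> A) (n : nat) (alpha : mono (2 * n - 2) -> k).
Local Notation S := {mpoly k[3]}.
Local Notation phi := (divpow_of alpha).
Local Notation pi := (presentation X).

Hypothesis A_graded : standard_graded gr.
Hypothesis X_basis : is_basis1 gr X.
Hypothesis pi_ker : forall f : S, pi f = 0 <-> annihilates f phi.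

Lemma piX i : pi 'X_i = X i.
Proof. by rewrite /presentation mmapX mmap1U. Qed.

Lemma basis_neq0 i : X i <> 0.
Proof.
move=> Xi0; have [_ free _] := X_basis.
have /eqP : (i == i)%:R = 0 :> k.
  apply: (free (fun j => (j == i)%:R)); rewrite (bigD1 i) //= Xi0 scaler0 add0r.
  by rewrite big1 // => j /negPf ->; rewrite scale0r.
by rewrite eqxx oner_eq0.
Qed.

(** If n is at most 1, then 2n-2 = 0 with truncated subtraction, so phi has
    degree 0 and is annihilated by the linear forms, which are nonzero in A. *)
Lemma n_gt1_of_basis : (1 < n)%N.
Proof.
rewrite ltnNge; apply/negP => len1; apply: (@basis_neq0 ix); rewrite -piX.
apply: (@pi_ker_high_degree _ _ _ _ _ pi_ker _ 1);
  first by rewrite dhomogX /= mdeg1.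
lia.
Qed.

Lemma pi_graded d f : f \is d.-homog -> gr d (pi f).
Proof.
move=> /dhomogP homf; rewrite /presentation /mmap big_seq.
have [gr0 grD] := gr_subspace A_graded d.
have gr1 i : gr 1 (X i) by case: X_basis.
have gr_one : gr 0 1 by apply/(gr_0 A_graded); exists 1; rewrite scale1r.
have gr_exp a e : gr 1 a -> gr e (a ^+ e).
  move=> gra; elim: e => [|e IHe]; first by rewrite expr0.
  by rewrite exprS -add1n; apply: (gr_mul A_graded).
have gr_monomial m : gr (mdeg m) (mmap1 X m).
  rewrite mdegE /mmap1; elim/big_ind2: _ => // [a i b j|i _];
    last exact: gr_exp.
  exact: (gr_mul A_graded).
elim/big_ind: _ => // [a b gra grb|m mf].
  by rewrite -[a]scale1r; apply: grD.
have := gr_monomial m; rewrite (homf m mf) /= mulr_algl => grm.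
by rewrite -[_ *: _]addr0; apply: grD.
Qed.

(** The homogeneous components of a preimage of a map to the homogeneous
    components of a, which vanish outside degree d as the sum is direct. *)
Lemma homog_component d a : (exists f, pi f = a) -> gr d a ->
  exists2 f, f \is d.-homog & pi f = a.
Proof.
move=> [f <-] grf; exists (pihomog mdeg d f); first exact: pihomogP.
pose N := maxn (msize f) d.+1.
pose c i := pi (pihomog mdeg i f) - (if i == d then pi f else 0).
have grc i : gr i (c i).
  have [gr0 grD] := gr_subspace A_graded i.
  rewrite /c addrC -scaleN1r; apply: (grD); last exact/pi_graded/pihomogP.
  by case: eqP => [->|].
have c0 : \sum_(i < N) c i = 0.
  have ltd : (d < N)%N by rewrite leq_maxr.
  rewrite sumrB [X in _ - X](bigD1 (Ordinal ltd)) //= eqxx.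
  rewrite [X in _ - (_ + X)]big1 => [|i nei]; last first.
    by rewrite -val_eqE in nei; rewrite (negPf nei).
  rewrite addr0 -raddf_sum /= -(pihomog_partitionE (mf := mdeg)) ?subrr //.
  by rewrite leq_maxl.
have := gr_direct A_graded grc c0; move/(_ d); rewrite leq_maxr => /(_ isT).
by rewrite /c eqxx => /eqP; rewrite subr_eq0 => /eqP.
Qed.

Lemma inverse_system_socle_degree :
  (forall a, exists f, pi f = a) -> socle_degree gr (2 * n - 2).
Proof.
move=> onto; split; last first.
  move=> i a lti gra; have [f homf <-] := homog_component (onto a) gra.
  exact: (pi_ker_high_degree pi_ker homf lti).
have [m degm phim] : exists2 m, mdeg m = (2 * n - 2)%N & phi m != 0.
  case: (pickP (fun u => alpha u != 0)) => [u au|a0].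
    exists (mval u); first exact: mdeg_mval.
    by rewrite (@divpow_ofE _ _ _ _ u).
  case: (@basis_neq0 ix); rewrite -[X ix]mul1r.
  have -> : 1 = pi 1 by rewrite rmorph1.
  suff -> : pi 1 = 0 by rewrite mul0r.
  apply/pi_ker => m; rewrite contractE mul1r pairingX /divpow_of big1 // => u _.
  by move/negbFE/eqP: (a0 u) => ->; rewrite mul0r.
exists (pi 'X_[m]); first by apply: pi_graded; rewrite dhomogX /= degm.
move/pi_ker/(_ 0%MM); rewrite contractX addm0 => /eqP; exact/negP.
Qed.

End GorensteinAlgebra.

Theorem theorem4p1 (k : fieldType) (A : comAlgType k) (gr : nat -> A -> Prop)
  (X : 'I_3 -> A) (n s1 s2 s3 : nat) (alpha : mono (2 * n - 2) -> k)
  (A_graded : standard_graded gr)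
  (A_artinian : artinian A)
  (A_gorenstein : gorenstein gr)
  (X_basis : is_basis1 gr X)
  (A_linear : gorenstein_linear (presentation X) n s1 s2 s3)
  (alpha_inverse_system : forall f : {mpoly k[3]},
     presentation X f = 0%R <-> annihilates f (divpow_of alpha)) :
  let SB := base_change (specialize alpha) (BB n) in
  [/\ (2 <= n)%N,
      socle_degree gr (2 * n - 2),
      pure_resolution (presentation X) SB n n.+1 (2 * n).+1
    & [/\ forall i j, d1 SB i j = specialize alpha (d1 (BB n) i j),
          forall i j, d2 SB i j = specialize alpha (d2 (BB n) i j)
        & forall i j, d3 SB i j = specialize alpha (d3 (BB n) i j)]].
Proof.
move=> SB; have [M1 [M2 [M3 res]]] := A_linear.
have n_gt1 := n_gt1_of_basis X_basis alpha_inverse_system.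
split=> //; last by split=> i j; rewrite mxE.
  exact: (inverse_system_socle_degree A_graded X_basis alpha_inverse_system
    (res_onto res)).
suff -> : SB = Complex3 (gens_col n (divpow_of alpha)) (syz n (divpow_of alpha))
    (gens_col n (divpow_of alpha))^T.
  exact: (syz_resolution n_gt1 res alpha_inverse_system).
rewrite /SB /base_change /=; congr Complex3; apply/matrixP => i j; rewrite ?mxE.
- by rewrite specialize_d1.
- by rewrite specialize_d2 mxE.
- by rewrite specialize_d1.
Qed.
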